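(* Let $(A,\mathfrak{g})$ be a Lie Rinehart pair with exterior power $\bigwedge\mathfrak{g}_A$. Then $\left(\bigwedge\mathfrak{g}_A,(\{\cdot,\ldots,\cdot\}_k)_{k\in\mathbb{N}}\right)$, where $\{\cdot,\ldots,\cdot\}_k$ is the Lie $k$-bracket and the grading is the tensor grading, is a Lie $\infty$-algebra, concentrated in non negative degrees.
   Context: A Lie Rinehart pair $(A,\mathfrak{g})$ consists of a real associative commutative algebra $A$ with unit, a real Lie algebra $\mathfrak{g}$, an $A$-module structure $(a,x)\mapsto a\cdot x$ on the vector space $\mathfrak{g}$, and a Lie algebra morphism $D:\mathfrak{g}\to \mathrm{Der}(A)$, $x\mapsto D_x$, into the Lie algebra of ($\mathbb{R}$-linear) derivations of $A$ (with commutator bracket), such that the Leibniz rule $[x,a\cdot y]=D_x(a)\cdot y+a\cdot[x,y]$ holds for all $x,y\in\mathfrak{g}$, $a\in A$. $\bigwedge\mathfrak{g}_A=\bigoplus_{n\ge0}\bigwedge^n_A\mathfrak{g}$ is the exterior algebra of the $A$-module $\mathfrak{g}$, with $\bigwedge^0_A\mathfrak{g}=A$, $\bigwedge^1_A\mathfrak{g}=\mathfrak{g}$. For $x\in\bigwedge^n_A\mathfrak{g}$ the tensor degree is $|x|=n$. The antisymmetric Schouten-Nijenhuis bracket is the map $[\cdot,\cdot]:\bigwedge\mathfrak{g}_A\times\bigwedge\mathfrak{g}_A\to\bigwedge\mathfrak{g}_A$ defined by $[a,b]=0$ and $[x,a]=-[a,x]=D_x(a)$ for scalars $a,b\in A$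 and vectors $x\in\mathfrak{g}$, by $$[x_1\wedge\cdots\wedge x_n,y_1\wedge\cdots\wedge y_m]=\sum_{i,j}(-1)^{i+j}[x_i,y_j]\wedge x_1\wedge\cdots\wedge\widehat{x_i}\wedge\cdots\wedge x_n\wedge y_1\wedge\cdots\wedge\widehat{y_j}\wedge\cdots\wedge y_m$$ on simple tensors ($x_i,y_j\in\mathfrak{g}$, $n,m\ge1$, hats denote omission), and extended to all of $\bigwedge\mathfrak{g}_A$ by additivity. Between a scalar $a\in A$ and a simple tensor with $n\ge 1$ factors it reads $$[x_1\wedge\cdots\wedge x_n,a]=\sum_i(-1)^{n-i}D_{x_i}(a)\cdot x_1\wedge\cdots\wedge\widehat{x_i}\wedge\cdots\wedge x_n,\qquad [a,x_1\wedge\cdots\wedge x_n]=\sum_i(-1)^{i}D_{x_i}(a)\cdot x_1\wedge\cdots\wedge\widehat{x_i}\wedge\cdots\wedge x_n.$$ Signs and shuffles: $e(x)=(-1)^{|x|}$ for homogeneous $x$. The Koszul sign $e(s;x_1,\dots,x_k)\in\{\pm1\}$ of $s\in S_k$ is characterized by $x_1\otimes\cdots\otimes x_k=e(s;x_1,\dots,x_k)\,x_{s(1)}\otimes\cdots\otimes x_{s(k)}$ under the rule $x\otimes y=(-1)^{|x||y|}y\otimes x$. For $p\geq1,q\ge0$, $Sh(p,q)$ is the set of $s\in S_{p+q}$ with $s(1)<\cdots<s(p)$ and $s(p+1)<\cdots<s(p+q)$. The Lie $n$-bracket on $\bigwedge\mathfrak{g}_A$ is defined for $n\ge2$ and homogeneous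 $x_1,\dots,x_n$ by $$\{x_1,\ldots,x_n\}_n=\sum_{s\in Sh(2,n-2)}e(s;x_1,\ldots,x_n)\,e(x_{s(1)})\;x_{s(n)}\wedge\cdots\wedge x_{s(3)}\wedge[x_{s(2)},x_{s(1)}],$$ extended by additivity to all of $\bigwedge\mathfrak{g}_A$; the Lie $1$-bracket $\{\cdot\}_1$ is the zero operator. A Lie $\infty$-algebra $(V,(D_k)_{k\in\mathbb{N}})$ ($\mathbb{N}=\{1,2,\dots\}$) is a $\mathbb{Z}$-graded real vector space $V$ with $k$-multilinear (over $\mathbb{R}$) maps $D_k:V\times\cdots\times V\to V$, homogeneous of degree $-1$ and graded symmetric ($D_k(v_1,\dots,v_k)=e(s;v_1,\dots,v_k)D_k(v_{s(1)},\dots,v_{s(k)})$ for $s\in S_k$), such that for every $n\in\mathbb{N}$ and homogeneous $v_1,\dots,v_n\in V$ the weak Jacobi equation holds: $$\sum_{i+j=n+1}\ \sum_{s\in Sh(j,n-j)}e(s;v_1,\ldots,v_n)\,D_i\left(D_j(v_{s(1)},\ldots,v_{s(j)}),v_{s(j+1)},\ldots,v_{s(n)}\right)=0 .$$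
   Formalization: The Lie Rinehart pair is additionally required to have an A-linear anchor, D_{a·x}(b) = a D_x(b), as in the standard definition; without it the weak Jacobi equation can fail (A = R[t], t acting by 0 on g = span(x,y), [x,y] = y, D_x = t d/dt, D_y = t² d/dt). *)

(* Defs.v *)
From HB Require Import structures.
From mathcomp Require Import all_boot all_order all_algebra perm.
From mathcomp Require Import boolp reals.

Set Implicit Arguments.
Unset Strict Implicit.
Unset Printing Implicit Defensive.

Import Order.TTheory GRing.Theory Num.Theory.
Local Open Scope ring_scope.
Local Open Scope quotient_scope.

Section ExteriorAlgebra.
Variables (A : comPzRingType) (g : lmodType A).
Implicit Types (a b : A) (x y : g) (u v w : seq g).

(* A formal sum [(a1, w1); ...] of words stands for
   \sum_k a_k *: x_1 /\ ... /\ x_n over the words w_k = [x_1; ...; x_n]. *)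
Definition wsum := seq (A * seq g).
Implicit Types (s t : wsum).

(* The rules up to [ext_coefD] make the quotient the free A-module on words; adding
   [ext_slot] gives the tensor algebra T_A(g), and [ext_alt] divides it by the
   two-sided ideal generated by the x (x) x. *)
Inductive ext_rel : wsum -> wsum -> Prop :=
| ext_refl s : ext_rel s s
| ext_sym s t : ext_rel s t -> ext_rel t s
| ext_trans s t r : ext_rel s t -> ext_rel t r -> ext_rel s r
| ext_cat s t s' t' :
    ext_rel s t -> ext_rel s' t' -> ext_rel (s ++ s') (t ++ t')
| ext_swap s t : ext_rel (s ++ t) (t ++ s)
| ext_coef0 w : ext_rel [:: (0, w)] [::]
| ext_coefD a b w : ext_rel [:: (a, w); (b, w)] [:: (a + b, w)]
| ext_slot a b x y u v :
    ext_rel [:: (a, u ++ (b *: x + y) :: v)]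
            [:: (a * b, u ++ x :: v); (a, u ++ y :: v)]
| ext_alt a x u v : ext_rel [:: (a, u ++ x :: x :: v)] [::].

Definition ext_relb : rel wsum := fun s t => `[< ext_rel s t >].

Lemma ext_relb_equiv : equiv_class_of ext_relb.
Proof.
split=> [s|s t|s t r]; first exact/asboolP/ext_refl.
  by apply/asboolP/asboolP => /ext_sym.
by move=> /asboolP H1 /asboolP H2; apply/asboolP; apply: ext_trans H1 H2.
Qed.

Canonical ext_equiv := EquivRelPack ext_relb_equiv.

Definition ext : Type := {eq_quot ext_equiv}.
HB.instance Definition _ := Choice.on ext.
HB.instance Definition _ := EqQuotient.on ext.

Definition ext_sum s : ext := \pi_ext s.

Lemma ext_sumP s t : ext_sum s = ext_sum t <-> ext_rel s t.
Proof.
split=> [/eqmodP/asboolP //|H]; exact/eqmodP/asboolP.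
Qed.

Lemma ext_repr s : ext_rel (repr (ext_sum s)) s.
Proof. by apply/ext_sumP; rewrite /ext_sum reprK. Qed.

Lemma ext_sumK (X : ext) : ext_sum (repr X) = X.
Proof. by rewrite /ext_sum reprK. Qed.

Definition ext_add (X Y : ext) : ext := ext_sum (repr X ++ repr Y).
Definition wopp s : wsum := [seq (- m.1, m.2) | m <- s].
Definition ext_opp (X : ext) : ext := ext_sum (wopp (repr X)).

Lemma ext_add_sum s t : ext_add (ext_sum s) (ext_sum t) = ext_sum (s ++ t).
Proof. by apply/ext_sumP/ext_cat; apply: ext_repr. Qed.

Lemma ext_addA : associative ext_add.
Proof.
move=> X Y Z; rewrite -(ext_sumK X) -(ext_sumK Y) -(ext_sumK Z).
by rewrite !ext_add_sum catA.
Qed.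

Lemma ext_addC : commutative ext_add.
Proof. by move=> X Y; apply/ext_sumP/ext_swap. Qed.

Lemma ext_add0 : left_id (ext_sum [::]) ext_add.
Proof. by move=> X; rewrite -(ext_sumK X) ext_add_sum. Qed.

Lemma ext_addN : left_inverse (ext_sum [::]) ext_opp ext_add.
Proof.
move=> X; rewrite /ext_opp -[X in ext_add _ X]ext_sumK ext_add_sum.
apply/ext_sumP; elim: (repr X) => [|[a w] s IHs]; first exact: ext_refl.
apply: (@ext_trans _ ([:: (- a, w); (a, w)] ++ (wopp s ++ s))).
  rewrite /= -cat1s -[X in ext_rel _ X]cat1s.
  apply: ext_cat; first exact: ext_refl.
  rewrite -cat1s catA -[X in ext_rel _ X]cat1s catA.
  by apply: ext_cat; [exact: ext_swap | exact: ext_refl].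
rewrite -[X in ext_rel _ X]cat0s; apply: ext_cat => //.
by apply: ext_trans (ext_coefD _ _ _) _; rewrite addNr; exact: ext_coef0.
Qed.

HB.instance Definition _ :=
  GRing.isZmodule.Build ext ext_addA ext_addC ext_add0 ext_addN.

(* a *: x_1 /\ ... /\ x_n for w = [x_1; ...; x_n], and the scalar a for w = [::]. *)
Definition mon a w : ext := ext_sum [:: (a, w)].

Lemma ext_sum_cat s t : ext_sum (s ++ t) = ext_sum s + ext_sum t.
Proof. by rewrite -ext_add_sum. Qed.

Lemma ext_sumE s : ext_sum s = \sum_(m <- s) mon m.1 m.2.
Proof.
elim: s => [|[a w] s IHs]; first by rewrite big_nil.
by rewrite big_cons -cat1s ext_sum_cat IHs.
Qed.

Record alt_map (N : zmodType) (f : A -> seq g -> N) : Prop := AltMap {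
  alt_coefD : forall a b w, f (a + b) w = f a w + f b w;
  alt_slot : forall a b x y u v,
    f a (u ++ (b *: x + y) :: v) = f (a * b) (u ++ x :: v) + f a (u ++ y :: v);
  alt_alt : forall a x u v, f a (u ++ x :: x :: v) = 0 }.

(* Additive extension of [f] from the [mon a w] to the exterior algebra; it
   does not depend on the representative when [f] is an [alt_map], see
   [ext_lift_sum]. *)
Definition ext_lift (N : zmodType) (f : A -> seq g -> N) (X : ext) : N :=
  \sum_(m <- repr X) f m.1 m.2.

Lemma alt_coef0 (N : zmodType) (f : A -> seq g -> N) w :
  alt_map f -> f 0 w = 0.
Proof.
by move=> F; apply: (addIr (f 0 w)); rewrite -(alt_coefD F) !add0r.
Qed.

Lemma alt_map_rel (N : zmodType) (f : A -> seq g -> N) s t :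
  alt_map f -> ext_rel s t -> \sum_(m <- s) f m.1 m.2 = \sum_(m <- t) f m.1 m.2.
Proof.
move=> F; elim=> {s t}.
- by [].
- by [].
- by move=> s t r _ -> _ ->.
- by move=> s t s' t' _ H _ H'; rewrite !big_cat /= H H'.
- by move=> s t; rewrite !big_cat /= addrC.
- by move=> w; rewrite big_seq1 big_nil (alt_coef0 _ F).
- by move=> a b w; rewrite !big_cons !big_nil /= !addr0 (alt_coefD F).
- by move=> *; rewrite !big_cons !big_nil /= !addr0 (alt_slot F).
- by move=> *; rewrite big_seq1 big_nil (alt_alt F).
Qed.

Lemma ext_lift_sum (N : zmodType) (f : A -> seq g -> N) s :
  alt_map f -> ext_lift f (ext_sum s) = \sum_(m <- s) f m.1 m.2.
Proof. by move=> F; exact: alt_map_rel F (ext_repr s). Qed.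

Lemma ext_lift_mon (N : zmodType) (f : A -> seq g -> N) a w :
  alt_map f -> ext_lift f (mon a w) = f a w.
Proof. by move=> F; rewrite ext_lift_sum // big_seq1. Qed.

Lemma ext_liftD (N : zmodType) (f : A -> seq g -> N) : alt_map f ->
  {morph ext_lift f : X Y / X + Y}.
Proof.
move=> F X Y; rewrite -(ext_sumK X) -(ext_sumK Y) -ext_sum_cat.
by rewrite !ext_lift_sum // big_cat.
Qed.

Lemma alt_mon : alt_map mon.
Proof.
split=> *; first by rewrite /mon -ext_sum_cat; apply/ext_sumP/ext_sym/ext_coefD.
  by rewrite /mon -ext_sum_cat; apply/ext_sumP/ext_slot.
exact/ext_sumP/ext_alt.
Qed.

Lemma alt_monl a : alt_map (fun b w => mon (a * b) w).
Proof.
split=> *; first by rewrite mulrDr (alt_coefD alt_mon).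
  by rewrite (alt_slot alt_mon) mulrA.
exact: (alt_alt alt_mon).
Qed.

Definition ext_scale a : ext -> ext := ext_lift (fun b w => mon (a * b) w).

Lemma ext_scale_mon a b w : ext_scale a (mon b w) = mon (a * b) w.
Proof. exact/ext_lift_mon/alt_monl. Qed.

Lemma ext_scaleDr a : {morph ext_scale a : X Y / X + Y}.
Proof. exact/ext_liftD/alt_monl. Qed.

Lemma ext_ind (P : ext -> Prop) :
  P 0 -> (forall a w, P (mon a w)) -> (forall X Y, P X -> P Y -> P (X + Y)) ->
  forall X, P X.
Proof.
move=> P0 Pm PD X; rewrite -(ext_sumK X) ext_sumE.
by elim/big_rec: _ => // m Y _ PY; apply: PD.
Qed.

Lemma ext_scale0 a : ext_scale a 0 = 0.
Proof. by apply: (addIr (ext_scale a 0)); rewrite -ext_scaleDr !add0r. Qed.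

Lemma ext_scaleA a b X : ext_scale a (ext_scale b X) = ext_scale (a * b) X.
Proof.
elim/ext_ind: X => [|c w|X Y]; first by rewrite !ext_scale0.
  by rewrite !ext_scale_mon mulrA.
by rewrite !ext_scaleDr => -> ->.
Qed.

Lemma ext_scale1 : left_id 1 ext_scale.
Proof.
elim/ext_ind => [|c w|X Y]; first by rewrite !ext_scale0.
  by rewrite !ext_scale_mon mul1r.
by rewrite !ext_scaleDr => -> ->.
Qed.

Lemma ext_scaleDl X : {morph ext_scale^~ X : a b / a + b}.
Proof.
move=> a b /=; elim/ext_ind: X => [|c w|X Y]; first by rewrite !ext_scale0 addr0.
  by rewrite !ext_scale_mon mulrDl (alt_coefD alt_mon).
by rewrite !ext_scaleDr => -> ->; rewrite addrACA.
Qed.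

HB.instance Definition _ := GRing.Zmodule_isLmodule.Build A ext
  ext_scaleA ext_scale1 ext_scaleDr ext_scaleDl.

Lemma scale_mon a b w : a *: mon b w = mon (a * b) w.
Proof. exact: ext_scale_mon. Qed.

(* The wedge product: concatenation of words. *)
Definition ext_mul (X Y : ext) : ext :=
  ext_lift (fun a u => ext_lift (fun b v => mon (a * b) (u ++ v)) Y) X.

Lemma alt_cat_r a u : alt_map (fun b v => mon (a * b) (u ++ v)).
Proof.
split=> *; first by rewrite mulrDr (alt_coefD alt_mon).
  by rewrite !catA (alt_slot alt_mon) mulrA.
by rewrite catA (alt_alt alt_mon).
Qed.

Lemma alt_cat_l Y :
  alt_map (fun a u => ext_lift (fun b v => mon (a * b) (u ++ v)) Y).
Proof.
rewrite /ext_lift; split=> [a b w|a b x y u v|a x u v].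
- rewrite -big_split; apply: eq_bigr => m _ /=.
  by rewrite mulrDl (alt_coefD alt_mon).
- rewrite -big_split; apply: eq_bigr => m _ /=.
  by rewrite -!catA /= (alt_slot alt_mon) mulrAC.
- by apply: big1 => m _; rewrite -catA /= (alt_alt alt_mon).
Qed.

Lemma ext_mul_mon a b u v : ext_mul (mon a u) (mon b v) = mon (a * b) (u ++ v).
Proof.
by rewrite /ext_mul (ext_lift_mon _ _ (alt_cat_l _)) (ext_lift_mon _ _ (alt_cat_r _ _)).
Qed.

Lemma ext_mulDl : left_distributive ext_mul +%R.
Proof. by move=> X Y Z; apply/ext_liftD/alt_cat_l. Qed.

Lemma ext_mulDr : right_distributive ext_mul +%R.
Proof.
move=> X Y Z; rewrite -big_split; apply: eq_bigr => m _ /=.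
exact/ext_liftD/alt_cat_r.
Qed.

Lemma ext_mul0l X : ext_mul 0 X = 0.
Proof. by apply: (addIr (ext_mul 0 X)); rewrite -ext_mulDl !add0r. Qed.
Lemma ext_mul0r X : ext_mul X 0 = 0.
Proof. by apply: (addIr (ext_mul X 0)); rewrite -ext_mulDr !add0r. Qed.

Lemma ext_mulA : associative ext_mul.
Proof.
move=> X Y Z; elim/ext_ind: X => [|a u|X X']; first by rewrite !ext_mul0l.
  elim/ext_ind: Y => [|b v|Y Y']; first by rewrite !(ext_mul0l, ext_mul0r).
    elim/ext_ind: Z => [|c w|Z Z']; first by rewrite !(ext_mul0l, ext_mul0r).
      by rewrite !ext_mul_mon mulrA catA.
    by rewrite !ext_mulDr => -> ->.
  by rewrite !(ext_mulDl, ext_mulDr) => -> ->.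
by rewrite !ext_mulDl => -> ->.
Qed.

Lemma ext_mul1l : left_id (mon 1 [::]) ext_mul.
Proof.
elim/ext_ind => [|a u|X Y]; first by rewrite ext_mul0r.
  by rewrite ext_mul_mon mul1r.
by rewrite ext_mulDr => -> ->.
Qed.

Lemma ext_mul1r : right_id (mon 1 [::]) ext_mul.
Proof.
elim/ext_ind => [|a u|X Y]; first by rewrite ext_mul0l.
  by rewrite ext_mul_mon mulr1 cats0.
by rewrite ext_mulDl => -> ->.
Qed.

HB.instance Definition _ := GRing.Zmodule_isPzRing.Build ext
  ext_mulA ext_mul1l ext_mul1r ext_mulDl ext_mulDr.

Lemma mul_mon a b u v : mon a u * mon b v = mon (a * b) (u ++ v).
Proof. exact: ext_mul_mon. Qed.

(* The degree 0 and degree 1 parts are A and g. *)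
Lemma mon_nil_inj : injective (fun a => mon a [::]).
Proof.
have F : alt_map (fun a w => if w is [::] then a else 0).
  by split=> [a b [|x w]|a b x y [|z u] v|a x [|z u] v] //=; rewrite addr0.
by move=> a b /(congr1 (ext_lift (fun a w => if w is [::] then a else 0)));
  rewrite !ext_lift_mon.
Qed.

Lemma mon_seq1_inj : injective (fun x => mon 1 [:: x]).
Proof.
pose f a w : g := if w is [:: x] then a *: x else 0.
have F : alt_map f.
  split=> [a b [|x [|y w]]|a b x y [|z [|t u]] [|t' v]|a x [|z [|t u]] v] //=;
    rewrite ?addr0 //; first exact: scalerDl.
  by rewrite scalerDr scalerA.
by move=> x y /(congr1 (ext_lift f)); rewrite !ext_lift_mon //= !scale1r.
Qed.

End ExteriorAlgebra.

(* Restriction of scalars: a real algebra [A] is given by its structure morphism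
   [eta : R -> A] (library algebras exclude the zero ring), and every A-module
   is a real vector space through [eta]. *)
Definition restr (R A : pzRingType) (eta : {rmorphism R -> A}) (M : lmodType A)
  : Type := M.

Section RestrictionOfScalars.
Variables (R A : pzRingType) (eta : {rmorphism R -> A}) (M : lmodType A).

HB.instance Definition _ := GRing.Zmodule.on (restr eta M).

Definition restr_scale (r : R) (x : restr eta M) : restr eta M :=
  eta r *: (x : M).

Lemma restr_scaleA a b x :
  restr_scale a (restr_scale b x) = restr_scale (a * b) x.
Proof. by rewrite /restr_scale scalerA rmorphM. Qed.

Lemma restr_scale1 : left_id 1 restr_scale.
Proof. by move=> x; rewrite /restr_scale rmorph1 scale1r. Qed.

Lemma restr_scaleDr : right_distributive restr_scale +%R.
Proof. by move=> a x y; rewrite /restr_scale scalerDr. Qed.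

Lemma restr_scaleDl x : {morph restr_scale^~ x : a b / a + b}.
Proof. by move=> a b; rewrite /restr_scale rmorphD scalerDl. Qed.

HB.instance Definition _ := GRing.Zmodule_isLmodule.Build R (restr eta M)
  restr_scaleA restr_scale1 restr_scaleDr restr_scaleDl.

End RestrictionOfScalars.

(* [anchorZ] makes the anchor a morphism of A-modules into Der(A). The other
   axioms do not imply it when g is not faithful over A, and without it the
   weak Jacobi equations can fail: take A = R[t] acting on g = <x, y>,
   [x, y] = y, through t |-> 0, with D_x = t d/dt and D_y = t^2 d/dt; the
   equation at (x, y, t, t) then reads - 2 t^3 = 0. *)
Record lie_rinehart (R : realType) (A : comPzRingType)
    (eta : {rmorphism R -> A}) (g : lmodType A) := LieRinehart {
  lbr : g -> g -> g;
  anchor : g -> A -> A;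
  lbr_linl : forall (r : R) x y z,
    lbr (eta r *: x + y) z = eta r *: lbr x z + lbr y z;
  lbr_linr : forall (r : R) x y z,
    lbr z (eta r *: x + y) = eta r *: lbr z x + lbr z y;
  lbr_alt : forall x, lbr x x = 0;
  lbr_jacobi : forall x y z,
    lbr x (lbr y z) + lbr y (lbr z x) + lbr z (lbr x y) = 0;
  anchor_lin : forall x (r : R) a b,
    anchor x (eta r * a + b) = eta r * anchor x a + anchor x b;
  anchor_der : forall x a b, anchor x (a * b) = anchor x a * b + a * anchor x b;
  anchorD : forall x y a, anchor (x + y) a = anchor x a + anchor y a;
  anchorZ : forall b x a, anchor (b *: x) a = b * anchor x a;
  anchor_lbr : forall x y a,
    anchor (lbr x y) a = anchor x (anchor y a) - anchor y (anchor x a);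
  lbr_leibniz : forall x a y,
    lbr x (a *: y) = anchor x a *: y + a *: lbr x y }.

Section Brackets.
Variables (R : realType) (A : comPzRingType) (eta : {rmorphism R -> A}).
Variables (g : lmodType A) (L : lie_rinehart eta g).
Implicit Types (a b : A) (x y : g) (u v w X Y : seq g).

Definition omit (i : nat) w := take i w ++ drop i.+1 w.

(* [sn_vec_vec], [sn_vec_scal] and [sn_scal_vec] are the defining formulas on
   x_1 /\ ... /\ x_n with n > 0. Indices start at 0, so that i + j has the
   parity of the usual exponent, while n - i and i become n - (i + 1) and i + 1. *)
Definition sn_vec_vec X Y : ext g :=
  \sum_(i < size X) \sum_(j < size Y)
    mon ((-1) ^+ (i + j)) (lbr L X`_i Y`_j :: omit i X ++ omit j Y).

Definition sn_vec_scal X a : ext g :=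
  \sum_(i < size X) mon ((-1) ^+ (size X - i.+1) * anchor L X`_i a) (omit i X).

Definition sn_scal_vec a X : ext g :=
  \sum_(i < size X) mon ((-1) ^+ i.+1 * anchor L X`_i a) (omit i X).

(* Coefficients are absorbed in the first factor. *)
Definition sn_mon a X b Y : ext g :=
  match X, Y with
  | [::], [::] => 0
  | x :: X', [::] => sn_vec_scal (a *: x :: X') b
  | [::], y :: Y' => sn_scal_vec a (b *: y :: Y')
  | x :: X', y :: Y' => sn_vec_vec (a *: x :: X') (b *: y :: Y')
  end.

Definition sn (p q : ext g) : ext g :=
  ext_lift (fun a X => ext_lift (fun b Y => sn_mon a X b Y) q) p.

Lemma big_omit (N : zmodType) (T : nat -> g -> seq g -> N) u z v :
  \sum_(i < size (u ++ z :: v)) T i (u ++ z :: v)`_i (omit i (u ++ z :: v)) =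
  \sum_(i < size u) T i u`_i (omit i u ++ z :: v) + T (size u) z (u ++ v) +
  \sum_(i < size v) T (size u + i.+1)%N v`_i (u ++ z :: omit i v).
Proof.
rewrite size_cat /= addnS -addSn big_split_ord big_ord_recr /= /omit.
congr (_ + _ + _).
- apply: eq_bigr => i _; have iu := ltn_ord i.
  rewrite nth_cat iu take_cat iu drop_cat; case: ltnP => H.
    by rewrite -catA.
  have -> : i.+1 = size u by apply/eqP; rewrite eqn_leq iu H.
  by rewrite subnn drop_size cats0 drop0.
- by rewrite nth_cat ltnn subnn take_size_cat // drop_cat ltnNge leqnSn subSnn /= drop0.
- apply: eq_bigr => i _; rewrite addSnnS nth_cat take_cat drop_cat.
  rewrite !ltnNge leq_addr -addnS leq_addr !addKn /= -catA.
  by [].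
Qed.

Lemma monDr a u x y v : mon a (u ++ (x + y) :: v) = mon a (u ++ x :: v) + mon a (u ++ y :: v).
Proof. by have := alt_slot (alt_mon g) a 1 x y u v; rewrite scale1r mulr1. Qed.

Lemma mon_slot0 a u v : mon a (u ++ (0 : g) :: v) = 0.
Proof. by apply: (addIr (mon a (u ++ 0 :: v))); rewrite -monDr !add0r. Qed.

Lemma monZ a b u x v : mon a (u ++ (b *: x) :: v) = b *: mon a (u ++ x :: v).
Proof.
have := alt_slot (alt_mon g) a b x 0 u v.
by rewrite addr0 mon_slot0 addr0 scale_mon mulrC.
Qed.

Lemma mon_alt a u x v : mon a (u ++ x :: x :: v) = 0.
Proof. exact: alt_alt (alt_mon g) _ _ _ _. Qed.

Lemma monD a b w : mon (a + b) w = mon a w + mon b w.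
Proof. exact: alt_coefD (alt_mon g) _ _ _. Qed.

Lemma mon0 w : mon 0 w = 0.
Proof. exact: alt_coef0 _ (alt_mon g). Qed.

Lemma monN a w : mon (- a) w = - mon a w.
Proof. by apply/eqP; rewrite -subr_eq0 opprK -monD addNr mon0. Qed.

Lemma mon_swap a u x y v :
  mon a (u ++ x :: y :: v) = - mon a (u ++ y :: x :: v).
Proof.
apply/eqP; rewrite -subr_eq0 opprK; apply/eqP.
have := mon_alt a u (x + y) v; rewrite monDr -cat_rcons monDr cat_rcons.
rewrite mon_alt add0r -[_ ++ y :: _ :: _]cat_rcons monDr !cat_rcons.
by rewrite mon_alt addr0.
Qed.

Lemma mon_move a u x v :
  mon a (x :: u ++ v) = mon ((-1) ^+ size u * a) (u ++ x :: v).
Proof.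
elim: u v a => [|y u IH] v a /=; first by rewrite mul1r.
rewrite -[RHS]scale1r scale_mon mul1r.
have -> : mon a [:: x, y & u ++ v] = - mon a [:: y, x & u ++ v].
  exact: (mon_swap a [::]).
have -> (c : A) z w : mon c (z :: w) = mon 1 [:: z] * mon c w.
  by rewrite mul_mon mul1r.
by rewrite IH mul_mon mul1r exprS -mulrA mulN1r monN.
Qed.

(* [K] is the symbol of the first order operator [F]. *)
Record slotwise (F : seq g -> ext g) (K : A -> seq g -> ext g) : Prop := Slotwise {
  slotD : forall u x y v, F (u ++ (x + y) :: v) = F (u ++ x :: v) + F (u ++ y :: v);
  slotZ : forall b u x v, F (u ++ (b *: x) :: v) = b *: F (u ++ x :: v) + K b (u ++ x :: v);
  slotA : forall u x v, F (u ++ x :: x :: v) = 0;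
  slotK : forall b u x v, K b (u ++ x :: x :: v) = 0 }.

Lemma slotwise_alt F K (f0 : A -> ext g) : slotwise F K -> {morph f0 : a b / a + b} ->
  alt_map (fun a X => if X is x :: X' then F (a *: x :: X') else f0 a).
Proof.
move=> H f0D; split=> [a b [|x w]|a b x y [|z u] v|a x [|z u] v] //=.
- by rewrite scalerDl; apply: (slotD H [::]).
- by rewrite scalerDr scalerA; apply: (slotD H [::]).
- rewrite -!cat_cons (slotD H) (slotZ H) mulrC -scalerA; congr (_ + _).
  exact/esym/(slotZ H b [::] (a *: z) (u ++ x :: v)).
- have := slotZ H a [::] x (x :: v); rewrite /= => ->.
  by rewrite (slotA H [::]) (slotK H a [::]) scaler0 addr0.
- exact: (slotA H (_ :: _)).
Qed.

Lemma slotwise_sum (T : nat -> g -> seq g -> ext g) (T' : A -> nat -> g -> seq g -> ext g) K :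
  (forall i x y W, T i (x + y) W = T i x W + T i y W) ->
  (forall i x u y z v, T i x (u ++ (y + z) :: v) = T i x (u ++ y :: v) + T i x (u ++ z :: v)) ->
  (forall b i x W, T i (b *: x) W = b *: T i x W + T' b i x W) ->
  (forall b i x u y v, T i x (u ++ (b *: y) :: v) = b *: T i x (u ++ y :: v)) ->
  (forall i x u y v, T i x (u ++ y :: y :: v) = 0) ->
  (forall i x W, T i.+1 x W = - T i x W) ->
  (forall b u x v, T' b (size u) x (u ++ v) = K b (u ++ x :: v)) ->
  (forall b u x v, K b (u ++ x :: x :: v) = 0) ->
  slotwise (fun X => \sum_(i < size X) T i X`_i (omit i X)) K.
Proof.
move=> t1 t2 t3 t4 t5 t6 t7 t8; split=> //.
- move=> u x y v; rewrite !big_omit t1.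
  under eq_bigr do rewrite t2; under [X in _ + X = _]eq_bigr do rewrite t2.
  by rewrite !big_split /= [X in X + _ = _]addrACA; apply: addrACA.
- move=> b u x v; rewrite !big_omit t3.
  under eq_bigr do rewrite t4; under [X in _ + X = _]eq_bigr do rewrite t4.
  by rewrite -!scaler_sumr t7 !scalerDr addrA; apply: addrAC.
- move=> u x v; rewrite big_omit big1 => [|i _]; last exact: t5.
  rewrite add0r /= big_ord_recl /= big1 => [|i _]; last first.
    by rewrite /omit /= t5.
  by rewrite addr0 /omit /= drop0 addn1 t6 subrr.
Qed.


Lemma lbrDl x y z : lbr L (x + y) z = lbr L x z + lbr L y z.
Proof. by have := lbr_linl L 1 x y z; rewrite rmorph1 !scale1r. Qed.

Lemma lbrDr x y z : lbr L z (x + y) = lbr L z x + lbr L z y.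
Proof. by have := lbr_linr L 1 x y z; rewrite rmorph1 !scale1r. Qed.

Lemma lbrC x y : lbr L x y = - lbr L y x.
Proof.
apply/eqP; rewrite -subr_eq0 opprK; apply/eqP.
have := lbr_alt L (x + y); rewrite lbrDl !lbrDr !lbr_alt add0r addr0.
by [].
Qed.

Lemma lbrZl b x y : lbr L (b *: x) y = b *: lbr L x y - anchor L y b *: x.
Proof. by rewrite lbrC lbr_leibniz (lbrC y x) scalerN opprD opprK addrC. Qed.

Lemma anchorDr x a b : anchor L x (a + b) = anchor L x a + anchor L x b.
Proof. by have := anchor_lin L x 1 a b; rewrite rmorph1 !mul1r. Qed.

Lemma monNr c u x v : mon c (u ++ (- x) :: v) = - mon c (u ++ x :: v).
Proof. by rewrite -scaleN1r monZ scaleN1r. Qed.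

Lemma slotwise_vec_vec_l Y : slotwise (sn_vec_vec^~ Y)
  (fun b X => - \sum_(j < size Y) mon ((-1) ^+ j * anchor L Y`_j b) (X ++ omit j Y)).
Proof.
pose T i x W := \sum_(j < size Y) mon ((-1) ^+ (i + j)) (lbr L x Y`_j :: W ++ omit j Y).
pose T' b i x W := - \sum_(j < size Y)
   mon ((-1) ^+ (i + j) * anchor L Y`_j b) (x :: W ++ omit j Y).
apply: (@slotwise_sum T T'); rewrite /T /T'.
- move=> i x y W; rewrite -big_split; apply: eq_bigr => j _ /=.
  by rewrite lbrDl (monDr _ [::]).
- move=> i x u y z v; rewrite -big_split; apply: eq_bigr => j _ /=.
  by rewrite -!catA /= -!cat_cons monDr.
- move=> b i x W; rewrite scaler_sumr -sumrN -big_split; apply: eq_bigr => j _ /=.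
  rewrite lbrZl (monDr _ [::]) (monNr _ [::]) !(monZ _ _ [::]) /= !scale_mon.
  by rewrite [_ * anchor _ _ _]mulrC.
- move=> b i x u y v; rewrite scaler_sumr; apply: eq_bigr => j _ /=.
  by rewrite -!catA /= -!cat_cons monZ.
- move=> i x u y v; apply: big1 => j _ /=.
  by rewrite -!catA /= -!cat_cons mon_alt.
- move=> i x W; rewrite -sumrN; apply: eq_bigr => j _ /=.
  by rewrite addSn exprS mulN1r monN.
- move=> b u x v; congr (- _); apply: eq_bigr => j _.
  rewrite -!catA mon_move /= mulrA exprD mulrA -expr2 -exprM mulnC exprM sqrrN.
  by rewrite !expr1n mul1r.
- move=> b u x v; apply/eqP; rewrite oppr_eq0; apply/eqP/big1 => j _.
  by rewrite -catA mon_alt.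
Qed.

Lemma slotwise_vec_vec_r X : slotwise (sn_vec_vec X)
  (fun b Y => \sum_(i < size X)
    mon ((-1) ^+ (i + size (omit i X)) * anchor L X`_i b) (omit i X ++ Y)).
Proof.
pose T j y W := \sum_(i < size X) mon ((-1) ^+ (i + j)) (lbr L X`_i y :: omit i X ++ W).
pose T' b j y W := \sum_(i < size X)
   mon ((-1) ^+ (i + j) * anchor L X`_i b) (y :: omit i X ++ W).
have -> : sn_vec_vec X = fun Y => \sum_(j < size Y) T j Y`_j (omit j Y).
  by apply/funext => Y; rewrite /sn_vec_vec exchange_big.
apply: (@slotwise_sum T T'); rewrite /T /T'.
- move=> j x y W; rewrite -big_split; apply: eq_bigr => i _ /=.
  by rewrite lbrDr (monDr _ [::]).
- move=> j x u y z v; rewrite -big_split; apply: eq_bigr => i _ /=.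
  by rewrite !catA -!cat_cons monDr.
- move=> b j y W; rewrite scaler_sumr -big_split; apply: eq_bigr => i _ /=.
  rewrite lbr_leibniz (monDr _ [::]) !(monZ _ _ [::]) /= !scale_mon addrC.
  by rewrite [_ * anchor _ _ _]mulrC.
- move=> b j x u y v; rewrite scaler_sumr; apply: eq_bigr => i _ /=.
  by rewrite !catA -!cat_cons monZ.
- move=> j x u y v; apply: big1 => i _ /=.
  by rewrite !catA -!cat_cons mon_alt.
- move=> j x W; rewrite -sumrN; apply: eq_bigr => i _ /=.
  by rewrite addnS exprS mulN1r monN.
- move=> b u x v; apply: eq_bigr => i _.
  rewrite catA mon_move size_cat -catA mulrA -exprD; congr mon; congr (_ * _).
  rewrite -signr_odd -[in RHS]signr_odd; congr (_ ^+ _).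
  by rewrite !oddD; do 3!case: (odd _).
- move=> b u x v; apply: big1 => i _.
  by rewrite catA mon_alt.
Qed.

Lemma size_omit i w : (i < size w)%N -> size (omit i w) = (size w).-1.
Proof.
by move=> iw; rewrite size_cat size_take iw size_drop -[in RHS](subnKC iw) addSn.
Qed.

Lemma slotwise_vec_scal b : slotwise (sn_vec_scal^~ b) (fun _ _ => 0).
Proof.
pose T i x (W : seq g) := mon ((-1) ^+ (size W + i) * anchor L x b) W.
have -> : sn_vec_scal^~ b = fun X => \sum_(i < size X) T i X`_i (omit i X).
  apply/funext => X; apply: eq_bigr => i _; rewrite /T size_omit //.
  congr mon; congr (_ * _); rewrite -signr_odd -[in RHS]signr_odd.
  congr (_ ^+ _); rewrite oddD oddB // -subn1 oddB ?(leq_ltn_trans _ (ltn_ord i)) //=.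
  by do 2!case: (odd _).
apply: (@slotwise_sum T (fun _ _ _ _ => 0)) => //; rewrite /T.
- by move=> i x y W; rewrite anchorD mulrDr monD.
- by move=> i x u y z v; rewrite !size_cat monDr.
- by move=> c i x W; rewrite anchorZ addr0 scale_mon mulrCA.
- by move=> c i x u y v; rewrite !size_cat monZ.
- by move=> *; rewrite mon_alt.
- by move=> i x W; rewrite addnS exprS mulN1r mulNr monN.
Qed.

Lemma slotwise_scal_vec a : slotwise (sn_scal_vec a) (fun _ _ => 0).
Proof.
pose T i x (W : seq g) := mon ((-1) ^+ i.+1 * anchor L x a) W.
apply: (@slotwise_sum T (fun _ _ _ _ => 0)) => //; rewrite /T.
- by move=> i x y W; rewrite anchorD mulrDr monD.
- by move=> i x u y z v; rewrite monDr.
- by move=> c i x W; rewrite anchorZ addr0 scale_mon mulrCA.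
- by move=> c i x u y v; rewrite monZ.
- by move=> *; rewrite mon_alt.
- by move=> i x W; rewrite exprS mulN1r mulNr monN.
Qed.

Lemma sn_vec_scalD X : {morph sn_vec_scal X : a b / a + b}.
Proof.
move=> a b; rewrite -big_split; apply: eq_bigr => i _.
by rewrite anchorDr mulrDr monD.
Qed.

Lemma sn_scal_vecD X : {morph sn_scal_vec^~ X : a b / a + b}.
Proof.
move=> a b; rewrite -big_split; apply: eq_bigr => i _.
by rewrite anchorDr mulrDr monD.
Qed.

Lemma alt_sn_r a X : alt_map (sn_mon a X).
Proof.
case: X => [|x X].
  by apply: (slotwise_alt (slotwise_scal_vec a)) => b c; rewrite addr0.
exact: (slotwise_alt (slotwise_vec_vec_r _) (sn_vec_scalD _)).
Qed.

Lemma alt_sn_l b Y : alt_map (fun a X => sn_mon a X b Y).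
Proof.
case: Y => [|y Y].
  by apply: (slotwise_alt (slotwise_vec_scal b)) => a c; rewrite addr0.
exact: (slotwise_alt (slotwise_vec_vec_l _) (sn_scal_vecD _)).
Qed.

Lemma alt_sn_lift q : alt_map (fun a X => ext_lift (sn_mon a X) q).
Proof.
rewrite /ext_lift; split=> *.
- by rewrite -big_split; apply: eq_bigr => m _; apply: (alt_coefD (alt_sn_l _ _)).
- by rewrite -big_split; apply: eq_bigr => m _; apply: (alt_slot (alt_sn_l _ _)).
- by apply: big1 => m _; apply: (alt_alt (alt_sn_l _ _)).
Qed.

Lemma snDl : left_distributive sn +%R.
Proof. by move=> p p' q; apply/ext_liftD/alt_sn_lift. Qed.

Lemma snDr : right_distributive sn +%R.
Proof.
move=> p q q'; rewrite -big_split; apply: eq_bigr => m _ /=.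
exact/ext_liftD/alt_sn_r.
Qed.

Lemma sn_monE a X b Y : sn (mon a X) (mon b Y) = sn_mon a X b Y.
Proof.
by rewrite /sn (ext_lift_mon _ _ (alt_sn_lift _)) (ext_lift_mon _ _ (alt_sn_r _ _)).
Qed.

Lemma sn0l q : sn 0 q = 0.
Proof. by apply: (addIr (sn 0 q)); rewrite -snDl !add0r. Qed.

Lemma sn0r p : sn p 0 = 0.
Proof. by apply: (addIr (sn p 0)); rewrite -snDr !add0r. Qed.

(* For d < 0 only the empty sum remains. *)
Definition ext_homog (d : int) (p : ext g) : Prop :=
  exists2 s : wsum g, all (fun m => (size m.2)%:Z == d) s & p = ext_sum s.

Definition ext_comp (k : nat) : ext g -> ext g :=
  ext_lift (fun a w => if size w == k then mon a w else 0).

Lemma alt_comp k : alt_map (fun a w => if size w == k then mon a w else 0 : ext g).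
Proof.
split=> [a b w|a b x y u v|a x u v]; rewrite ?size_cat /=.
- by case: ifP => _; rewrite ?addr0 // monD.
- by case: ifP => _; rewrite ?addr0 // (alt_slot (alt_mon g)).
- by case: ifP => _ //; rewrite mon_alt.
Qed.

Lemma ext_comp_homog k (d : nat) p :
  ext_homog d p -> ext_comp k p = if k == d then p else 0.
Proof.
case=> s /allP hs ->; rewrite /ext_comp (ext_lift_sum _ (alt_comp k)) ext_sumE.
case: eqP => [->|kd].
  rewrite big_seq [RHS]big_seq; apply: eq_bigr => m /hs.
  by rewrite eqz_nat => ->.
rewrite big_seq; apply: big1 => m /hs; rewrite eqz_nat => /eqP ->.
by case: eqP => // E; case: kd.
Qed.

(* A strict upper bound on the degrees of the nonzero components of p. *)
Definition ext_bound (p : ext g) : nat := (\max_(m <- repr p) size m.2).+1.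

Lemma ext_comp_bound k p : (ext_bound p <= k)%N -> ext_comp k p = 0.
Proof.
rewrite /ext_comp /ext_lift /ext_bound => H; rewrite big_seq; apply: big1 => m mp.
case: eqP => // E; move: H; rewrite ltnNge -E.
by rewrite (@leq_bigmax_seq _ (repr p) xpredT (fun m => size m.2)).
Qed.

Lemma ext_comp_sum N p : (ext_bound p <= N)%N -> p = \sum_(k < N) ext_comp k p.
Proof.
move=> pN; rewrite -[LHS]ext_sumK ext_sumE /ext_comp /ext_lift exchange_big /=.
rewrite big_seq [RHS]big_seq; apply: eq_bigr => m mp.
have mN : (size m.2 < N)%N.
  apply: leq_trans pN; rewrite ltnS.
  by rewrite (@leq_bigmax_seq _ (repr p) xpredT (fun m => size m.2)).
rewrite (bigD1 (Ordinal mN)) //= eqxx big1 ?addr0 // => k.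
by rewrite -val_eqE /= eq_sym => /negbTE ->.
Qed.

End Brackets.

(* Every inversion of [s] costs one exchange of the factors d (s i), d (s j);
   [koszul1] and [koszul_tperm] are the characterization by the rule
   x (x) y = (-1)^(|x||y|) y (x) x. *)
Definition koszul n (d : 'I_n -> int) (s : 'S_n) : int :=
  \prod_(i < n) \prod_(j < n | (i < j)%N && (s j < s i)%N)
    (-1) ^+ (`|d (s i)| * `|d (s j)|)%N.

Lemma koszul1 n (d : 'I_n -> int) : koszul d 1 = 1.
Proof.
apply: big1 => i _; apply: big1 => j; rewrite !perm1.
by case/andP => ij ji; move: (ltn_trans ij ji); rewrite ltnn.
Qed.

Lemma koszul_tperm n (d : 'I_n -> int) (s : 'S_n) (a b : 'I_n) :
  b = a.+1 :> nat ->
  koszul d (tperm a b * s) = (-1) ^+ (`|d (s a)| * `|d (s b)|)%N * koszul d s.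
Proof.
move=> ab; set t := tperm a b.
pose f (p q : 'I_n) : int :=
  if (q < p)%N then (-1) ^+ (`|d p| * `|d q|)%N else 1.
have E (u : 'S_n) : koszul d u = \prod_(z : 'I_n * 'I_n | (z.1 < z.2)%N) f (u z.1) (u z.2).
  rewrite /koszul pair_big_dep /= big_mkcond [RHS]big_mkcond /=.
  by apply: eq_bigr => z _; rewrite /f; case: (z.1 < z.2)%N.
have ltab : (a < b)%N by rewrite ab.
have nab : a != b by rewrite -val_eqE /= ltn_eqF.
pose h (z : 'I_n * 'I_n) := (t z.1, t z.2).
have hK : involutive h by case=> x y; rewrite /h /= !tpermK.
rewrite !E (reindex_inj (inv_inj hK)) /=.
rewrite (bigD1 (b, a)) /= ?tpermL ?tpermR // [in RHS](bigD1 (a, b)) //=.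
rewrite !permM /t tpermL tpermR -/t mulrA; congr (_ * _).
  rewrite /f; have /eqP nsab : s a != s b by rewrite (inj_eq perm_inj).
  case: (ltngtP (s a) (s b)) => [_|_|/val_inj //]; rewrite ?mulr1 // mulnC //.
  by rewrite -exprD addnn -signr_odd odd_double.
apply: eq_big => [[x y]|[x y] _] /=; last by rewrite !permM !tpermK.
have ltb (c : 'I_n) : c != b -> (b < c)%N = (a < c)%N.
  by move=> cb; rewrite ab [in RHS]leq_eqVlt -ab eq_sym val_eqE (negbTE cb).
have gtb (c : 'I_n) : c != a -> (c < b)%N = (c < a)%N.
  by move=> ca; rewrite ab ltnS leq_eqVlt val_eqE (negbTE ca).
have ba : (b < a)%N = false by rewrite ltnNge ltnW.
have abF := negbTE nab; have baF : (b == a) = false by rewrite eq_sym.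
rewrite !xpair_eqE.
case: (tpermP a b x) => [->|->|/eqP xa /eqP xb];
case: (tpermP a b y) => [->|->|/eqP ya /eqP yb];
  rewrite ?eqxx ?ltnn ?andbF ?andbT ?abF ?baF ?ba //=.
- by rewrite ltb // yb andbT.
- by rewrite ltb // ya andbT.
- by rewrite gtb // xb andbF andbT.
- by rewrite gtb // xa andbF andbT.
- by rewrite (negbTE xa) (negbTE xb).
Qed.

Definition shuffle p n (s : 'S_n) : bool :=
  [forall i : 'I_n, forall j : 'I_n,
    (i < j)%N && ((j < p)%N || (p <= i)%N) ==> (s i < s j)%N].

Section LieBracket.
Variables (R : realType) (A : comPzRingType) (eta : {rmorphism R -> A}).
Variables (g : lmodType A) (L : lie_rinehart eta g).

(* The n-bracket of x with x i homogeneous of degree d i; the product runs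
   over x_{s(n)}, ..., x_{s(3)} in this order. *)
Definition lie_homog m (d : 'I_m.+2 -> nat) (x : 'I_m.+2 -> ext g) : ext g :=
  \sum_(s : 'S_m.+2 | shuffle 2 s)
    ((\prod_(k < m) x (s (inord (m.+1 - k)))) *
       sn L (x (s (inord 1))) (x (s (inord 0))))
    *~ (koszul (fun i => (d i)%:Z) s * (-1) ^+ d (s (inord 0))).

(* Additive extension over all decompositions into homogeneous components;
   see [lie_bracketE]. *)
Definition lie_bracket n : ('I_n -> ext g) -> ext g :=
  match n with
  | m.+2 => fun x =>
      \sum_(d : {ffun 'I_m.+2 -> 'I_(\max_i ext_bound (x i))})
        lie_homog (fun i => d i) (fun i => ext_comp (d i) (x i))
  | _ => fun=> 0
  end.

Lemma lie_homog0 m (d : 'I_m.+2 -> nat) (x : 'I_m.+2 -> ext g) i :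
  x i = 0 -> lie_homog d x = 0.
Proof.
move=> xi; apply: big1 => s _; suff -> : (\prod_(k < m) x (s (inord (m.+1 - k)))) *
       sn L (x (s (inord 1))) (x (s (inord 0))) = 0 by rewrite mul0rz.
pose j := s^-1%g i; have sj : x (s j) = 0 by rewrite permKV.
have [j0|] := eqVneq (j : nat) 0%N.
  have <- : j = inord 0 by apply: val_inj; rewrite /= inordK.
  by rewrite sj sn0r mulr0.
have [j1|] := eqVneq (j : nat) 1%N.
  have <- : j = inord 1 by apply: val_inj; rewrite /= inordK.
  by rewrite sj sn0l mulr0.
move=> j1 j0; have jm := ltn_ord j.
have km : (m.+1 - j < m)%N by move: j0 j1 jm; case: (j : nat) => [|[|l]] //=; rewrite !ltnS subSS; case: (m) => // m' _ _ _; rewrite ltnS subSS leq_subr.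
suff -> : \prod_(k < m) x (s (inord (m.+1 - k))) = 0 by rewrite mul0r.
have E : inord (m.+1 - (m.+1 - j)) = j by rewrite subKn // inord_val.
pose r := index_enum 'I_m; have: Ordinal km \in r by rewrite mem_index_enum.
rewrite -/r; elim: r => // k r IH; rewrite in_cons big_cons => /orP [/eqP <-|/IH ->].
  by rewrite /= E sj mul0r.
by rewrite mulr0.
Qed.

Lemma lie_bracketE m (d : 'I_m.+2 -> nat) (x : 'I_m.+2 -> ext g) :
  (forall i, ext_homog (d i) (x i)) -> lie_bracket x = lie_homog d x.
Proof.
move=> hx; rewrite /lie_bracket; set N := \max_i _.
have [dN|] := boolP [forall i, d i < N]%N; last first.
  rewrite negb_forall => /existsP [i]; rewrite -leqNgt => Ni.
  have xi : x i = 0.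
    have := ext_comp_homog (d i) (hx i); rewrite eqxx => <-.
    by apply/ext_comp_bound/(leq_trans _ Ni)/(leq_bigmax i).
  rewrite (lie_homog0 _ xi); apply: big1 => d' _; apply: (@lie_homog0 _ _ _ i).
  by rewrite (ext_comp_homog _ (hx i)) xi if_same.
have /forallP dN' := dN.
pose d0 : {ffun 'I_m.+2 -> 'I_N} := [ffun i => Ordinal (dN' i)].
rewrite (bigD1 d0) //= [X in _ + X]big1 ?addr0 => [|d' nd].
  congr lie_homog; apply/funext => i; rewrite ffunE //=.
  by rewrite (ext_comp_homog _ (hx i)) eqxx.
have [i di] : exists i, d' i != d i :> nat.
  apply/existsP; rewrite -negb_forall; apply: contraNN nd => /forallP H.
  by apply/eqP/ffunP => i; apply: val_inj; rewrite ffunE /=; apply/eqP/H.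
apply: (@lie_homog0 _ _ _ i).
by rewrite (ext_comp_homog _ (hx i)) (negbTE di).
Qed.

End LieBracket.

(* V is the direct sum of the subspaces G d, d : int. *)
Record is_grading (R : pzRingType) (V : lmodType R) (G : int -> V -> Prop) :
    Prop := IsGrading {
  homog0 : forall d, G d 0;
  homog_lin : forall d (r : R) x y, G d x -> G d y -> G d (r *: x + y);
  homog_span : forall x, exists (s : seq int) (c : int -> V),
    (forall d, G d (c d)) /\ x = \sum_(d <- s) c d;
  homog_free : forall (s : seq int) (c : int -> V), uniq s ->
    (forall d, G d (c d)) -> \sum_(d <- s) c d = 0 ->
    forall d, d \in s -> c d = 0 }.

(* Only the D k with k > 0 matter. In [linf_jacobi], with n.+1 arguments, the
   inner arity is j.+1 and the outer one is (n - j).+1; all [inord] are in range. *)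
Record lie_infinity (R : realType) (V : lmodType R) (G : int -> V -> Prop)
    (D : forall k, ('I_k -> V) -> V) : Prop := LieInfinity {
  linf_grading : is_grading G;
  linf_linear : forall k (v : 'I_k.+1 -> V) (p : 'I_k.+1) (r : R) (x y : V),
    D k.+1 (dfwith (i := p) v (r *: x + y)) =
      r *: D k.+1 (dfwith (i := p) v x) + D k.+1 (dfwith (i := p) v y);
  linf_degree : forall k (d : 'I_k.+1 -> int) (v : 'I_k.+1 -> V),
    (forall i, G (d i) (v i)) -> G (\sum_i d i - 1) (D k.+1 v);
  linf_symmetric : forall k (d : 'I_k.+1 -> int) (v : 'I_k.+1 -> V) (s : 'S_k.+1),
    (forall i, G (d i) (v i)) ->
    D k.+1 v = D k.+1 (fun i => v (s i)) *~ koszul d s;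
  linf_jacobi : forall n (d : 'I_n.+1 -> int) (v : 'I_n.+1 -> V),
    (forall i, G (d i) (v i)) ->
    \sum_(j < n.+1) \sum_(s : 'S_n.+1 | shuffle j.+1 s)
      D (n - j).+1 (fun i =>
        if i == 0%N :> nat then D j.+1 (fun l => v (s (inord l)))
        else v (s (inord (j + i)))) *~ koszul d s = 0 }.

(* Main.v *)
Require Import Defs.
From mathcomp Require Import all_boot all_order all_algebra perm.
From mathcomp Require Import boolp reals zify.
From Stdlib Require List.

Set Implicit Arguments.
Unset Strict Implicit.
Unset Printing Implicit Defensive.

Import Order.TTheory GRing.Theory Num.Theory.
Local Open Scope ring_scope.

(** Write x . y for y /\ x, the exterior product read backwards, and
    B(x, y) = (-1)^|x| [y, x]. The Schouten-Nijenhuis bracket makes the exterior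
    algebra a Gerstenhaber algebra ([sn_gerstenhaber]). In terms of B this says
    that B has degree -1, is graded symmetric, is a derivation in each argument,
    and that the graded sum of B(B(x, y), z) over the three ways of choosing z
    vanishes ([odot_jacobi]). Nothing else about the exterior algebra enters the
    weak Jacobi equations.

    The n-bracket of x_1, ..., x_n is the signed sum, over the choices of two of
    the arguments, of B of these two times the product of the others. The weak
    Jacobi equations are then best understood on an even formal variable x, of
    which they are the polarization. Up to factorials the n-bracket of (x, ..., x)
    is B(x, x) . x^(n-2), and since B is a derivation the composites of two
    brackets are combinations of
      B(B(x, x), x) . x^k   and   B(x, x) . B(x, x) . x^k.
    The first vanishes by the Jacobi identity; the second does because B(x, x) is
    odd, so that its square is equal to its own opposite.

    The polarized form of the argument is carried by [unsum], the signed sum over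
    all ways of splitting a list into two complementary sublists. It satisfies the
    coassociativity and cocommutativity laws of the shuffle coproduct
    ([unsum_coassoc], [unsum_cocomm]), which replace the associativity and
    commutativity of products of powers of x. In this language the n-bracket is
    [word_bracket], the odd square argument is [odd_square0], the Jacobi identity
    is [odot_jacobi_word], and they are assembled in [word_bracket_jacobi].

    The passage from sums over shuffle permutations with Koszul signs to [unsum]
    is an induction on the number of arguments ([sum_shuffle]): a shuffle puts the
    first argument at the head of one of the two blocks, and removing it leaves a
    shuffle of the others. The same removal gives the graded symmetry of the
    brackets ([koszul_symmetric]). *)

(** * Signs *)

(** [parity] proves identities between exponents of -1, written with [&&], [(+)]
    and [~~], by truth tables over their atoms. *)
Ltac case_atom b :=
  lazymatch b with
  | true => fail | false => fail | negb _ => fail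
  | andb _ _ => fail | addb _ _ => fail | _ => case: b => //=
  end.
Ltac parity :=
  repeat match goal with
  | |- context [andb ?b _] => case_atom b
  | |- context [andb _ ?b] => case_atom b
  | |- context [addb ?b _] => case_atom b
  | |- context [addb _ ?b] => case_atom b
  | |- context [negb ?b] => case_atom b
  end; try done.

Section Sign.
Variable M : zmodType.
Implicit Types (b c : bool) (x y : M).

Definition sg b x : M := if b then - x else x.

Lemma sgM b c x : sg b (sg c x) = sg (b (+) c) x.
Proof. by case: b; case: c; rewrite /= ?opprK. Qed.

Lemma sgD b x y : sg b (x + y) = sg b x + sg b y.
Proof. by case: b; rewrite /= ?opprD. Qed.

Lemma sg0 b : sg b 0 = 0.
Proof. by case: b; rewrite /= ?oppr0. Qed.

Lemma sgN b x : sg b (- x) = sg (~~ b) x.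
Proof. by case: b; rewrite /= ?opprK. Qed.

Lemma oppr_sg b x : - sg b x = sg (~~ b) x.
Proof. by case: b; rewrite /= ?opprK. Qed.

Lemma sgDN b x : sg b x + sg (~~ b) x = 0.
Proof. by case: b; rewrite /= ?addNr ?subrr. Qed.

Lemma sgDNE b c x : c = ~~ b -> sg b x + sg c x = 0.
Proof. by move=> ->; exact: sgDN. Qed.

End Sign.

Lemma sg_morph (M N : zmodType) (h : M -> N) : {morph h : x y / x + y} ->
  forall b, {morph h : x / sg b x}.
Proof.
move=> hD [] x //=; have h0 : h 0 = 0 by apply: (addrI (h 0)); rewrite -hD !addr0.
by apply: (addIr (h x)); rewrite -hD !addNr h0.
Qed.

Lemma sg_sum (M : zmodType) (b : bool) (I : Type) (r : seq I) (P : pred I) (F : I -> M) :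
  sg b (\sum_(i <- r | P i) F i) = \sum_(i <- r | P i) sg b (F i).
Proof. by case: b => //=; rewrite sumrN. Qed.

Lemma mulrz_sign (M : zmodType) (b : bool) (x : M) : x *~ (-1) ^+ b = sg b x.
Proof. by case: b; rewrite ?mulrN1z ?mulr1z. Qed.

Section SignRing.
Variable V : pzRingType.
Implicit Types (b c : bool) (x y : V).

Lemma sgMl b x y : sg b x * y = sg b (x * y).
Proof. by case: b; rewrite /= ?mulNr. Qed.

Lemma sgMr b x y : x * sg b y = sg b (x * y).
Proof. by case: b; rewrite /= ?mulrN. Qed.

End SignRing.

(** * Signed sums over unshuffles *)

(** [unshuffle w I J] is the context available under a sum over the splittings of
    [w]: the additivity of lengths and degrees, and homogeneity of the entries, are
    inherited by [I] and [J] through it. *)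
Inductive unshuffle (T : Type) : seq T -> seq T -> seq T -> Prop :=
| unsh_nil : unshuffle [::] [::] [::]
| unsh_l x w I J : unshuffle w I J -> unshuffle (x :: w) (x :: I) J
| unsh_r x w I J : unshuffle w I J -> unshuffle (x :: w) I (x :: J).

Lemma unshuffle_size T (w I J : seq T) :
  unshuffle w I J -> (size I + size J)%N = size w.
Proof. by elim=> //= x {}w {}I {}J _ <-; rewrite ?addnS. Qed.

Lemma unshuffle_forall T (P : T -> Prop) (w I J : seq T) :
  unshuffle w I J -> List.Forall P w -> List.Forall P I /\ List.Forall P J.
Proof.
by elim=> //= x {}w {}I {}J _ IH /List.Forall_cons_iff [Px /IH []]; split=> //;
  constructor.
Qed.

Section Unshuffle.
Variables (T : Type) (par : T -> bool).
Implicit Types (w I J K : seq T).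

Definition par_word w : bool := foldr (fun x b => par x (+) b) false w.

Lemma par_word_cat w w' : par_word (w ++ w') = par_word w (+) par_word w'.
Proof. by elim: w => //= x w ->; rewrite addbA. Qed.

Lemma unshuffle_par w I J :
  unshuffle w I J -> par_word w = par_word I (+) par_word J.
Proof. by elim=> //= x {}w {}I {}J _ ->; [exact: addbA | exact: addbCA]. Qed.

(** The sign is the Koszul sign of bringing [I] in front of [J]: sending the head
    [x] of the list to [J] moves it across all of [I]. *)
Fixpoint unsum (M : zmodType) w (F : seq T -> seq T -> M) : M :=
  if w is x :: w' then
    unsum w' (fun I J => F (x :: I) J) +
    unsum w' (fun I J => sg (par x && par_word I) (F I (x :: J)))
  else F [::] [::].

Lemma eq_unsum (M : zmodType) w (F F' : seq T -> seq T -> M) :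
  (forall I J, unshuffle w I J -> F I J = F' I J) -> unsum w F = unsum w F'.
Proof.
elim: w F F' => [|x w IH] F F' E /=; first by apply: E; constructor.
congr (_ + _); apply: IH => I J wIJ; first by apply: E; constructor.
by congr sg; apply: E; constructor.
Qed.

Lemma unsumD (M : zmodType) w (F F' : seq T -> seq T -> M) :
  unsum w (fun I J => F I J + F' I J) = unsum w F + unsum w F'.
Proof.
elim: w F F' => [|x w IH] F F' //=; rewrite !IH [RHS]addrACA; congr (_ + _).
by rewrite -IH; apply: eq_unsum => I J _; rewrite sgD.
Qed.

Lemma unsum_morph (M N : zmodType) (h : M -> N) w F : {morph h : x y / x + y} ->
  h (unsum w F) = unsum w (fun I J => h (F I J)).
Proof.
move=> hD; elim: w F => //= x w IH F; rewrite hD !IH; congr (_ + _).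
by apply: eq_unsum => I J _; rewrite (sg_morph hD).
Qed.

Lemma unsum_sg (M : zmodType) b w (F : seq T -> seq T -> M) :
  sg b (unsum w F) = unsum w (fun I J => sg b (F I J)).
Proof. by apply: unsum_morph => x y; rewrite sgD. Qed.

Lemma unsum0 (M : zmodType) w (F : seq T -> seq T -> M) :
  (forall I J, unshuffle w I J -> F I J = 0) -> unsum w F = 0.
Proof.
elim: w F => [|x w IH] F E /=; first by apply: E; constructor.
rewrite !IH ?addr0 // => I J wIJ; rewrite E ?sg0 //; by constructor.
Qed.

Lemma unsum_sum (I : Type) (M : zmodType) w (r : seq I)
    (F : I -> seq T -> seq T -> M) :
  \sum_(i <- r) unsum w (F i) = unsum w (fun I J => \sum_(i <- r) F i I J).
Proof.
elim: r => [|i r IH]; first by rewrite big_nil unsum0 // => I' J _; rewrite big_nil.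
rewrite big_cons IH -unsumD; apply: eq_unsum => I' J _; by rewrite big_cons.
Qed.

(** Both sides sum over the splittings of [w] into three sublists. The sign of an
    entry that goes to [K] is computed against [I] on the left and against [I1]
    and then [I2] on the right; these agree because the parity of [I] is the sum of
    those of [I1] and [I2]. *)
Lemma unsum_coassoc (M : zmodType) w (F : seq T -> seq T -> seq T -> M) :
  unsum w (fun I K => unsum I (fun I1 I2 => F I1 I2 K)) =
  unsum w (fun I1 J => unsum J (fun I2 K => F I1 I2 K)).
Proof.
elim: w F => //= x w IH F; rewrite unsumD.
under [X in _ = _ + X]eq_unsum => I J _ do rewrite sgD.
rewrite unsumD -addrA (IH (fun I J K => F (x :: I) J K)); congr (_ + _).
under [X in _ = X + _]eq_unsum => I J _ do rewrite unsum_sg.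
under [X in _ = _ + X]eq_unsum => I J _ do rewrite unsum_sg.
rewrite (IH (fun I J K => sg (par x && par_word I) (F I (x :: J) K))).
rewrite -(IH (fun I J K => sg (par x && par_word I)
  (sg (par x && par_word J) (F I J (x :: K))))).
congr (_ + _); apply: eq_unsum => I J _; rewrite unsum_sg.
apply: eq_unsum => I1 I2 /unshuffle_par ->; rewrite sgM; congr sg.
by rewrite andb_addr.
Qed.

Lemma unsum_cocomm (M : zmodType) w (F : seq T -> seq T -> M) :
  unsum w F = unsum w (fun I J => sg (par_word I && par_word J) (F J I)).
Proof.
elim: w F => //= x w IH F; rewrite addrC; congr (_ + _); rewrite IH;
  apply: eq_unsum => I J _; rewrite !sgM; congr sg;
  by case: (par x); case: (par_word I); case: (par_word J).
Qed.

Lemma unsum_left_nil (M : zmodType) w (f : seq T -> M) :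
  unsum w (fun I J => if I is [::] then f J else 0) = f w.
Proof.
elim: w f => //= x w IH f.
rewrite unsum0 // add0r -[RHS](IH (fun J => f (x :: J))); apply: eq_unsum.
by case=> [|y I] J _; rewrite ?andbF ?sg0.
Qed.

Lemma unsum_right_nil (M : zmodType) w (f : seq T -> M) :
  unsum w (fun I J => if J is [::] then f I else 0) = f w.
Proof.
rewrite unsum_cocomm -[RHS](unsum_left_nil w f); apply: eq_unsum.
by case=> [|y I] J _; rewrite ?sg0.
Qed.

(** The expression is graded symmetric in two neighbours of the list as soon as it
    is when both fall in the same block: when they fall in different blocks, the
    sign comes from the splitting. *)
Lemma unsum_swap (M : zmodType) x y u v (F : seq T -> seq T -> M) :
  (forall u' v' J,
     F (u' ++ x :: y :: v') J = sg (par x && par y) (F (u' ++ y :: x :: v') J)) ->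
  (forall I u' v',
     F I (u' ++ x :: y :: v') = sg (par x && par y) (F I (u' ++ y :: x :: v'))) ->
  unsum (u ++ x :: y :: v) F = sg (par x && par y) (unsum (u ++ y :: x :: v) F).
Proof.
elim: u F => [|z u IH] F Fl Fr /=.
  rewrite !sgD !unsum_sg -!addrA; congr (_ + _).
    by apply: eq_unsum => I J _; apply: (Fl [::]).
  rewrite addrCA; congr (_ + (_ + _)); apply: eq_unsum => I J _; rewrite ?sgM.
  - by congr sg; parity.
  - by congr sg; parity.
  - by rewrite (Fr I [::] J) !sgM; congr sg; parity.
rewrite sgD; congr (_ + _); apply: IH => *; first exact: (Fl (_ :: _)).
- exact: Fr.
- rewrite Fl !par_word_cat /= !sgM; congr sg.
  by parity.
- by rewrite (Fr _ (_ :: _)) !sgM addbC.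
Qed.

Lemma unsum_slot (M : zmodType) x y z u v (h : M -> M) (F : seq T -> seq T -> M) :
  {morph h : a b / a + b} -> par x = par z -> par y = par z ->
  (forall u' v' J,
     F (u' ++ z :: v') J = h (F (u' ++ x :: v') J) + F (u' ++ y :: v') J) ->
  (forall I u' v',
     F I (u' ++ z :: v') = h (F I (u' ++ x :: v')) + F I (u' ++ y :: v')) ->
  unsum (u ++ z :: v) F = h (unsum (u ++ x :: v) F) + unsum (u ++ y :: v) F.
Proof.
move=> hD xz yz; elim: u F => [|t u IH] F Fl Fr /=.
  rewrite hD !(unsum_morph _ _ hD) addrACA.
  congr (_ + _); rewrite -unsumD; apply: eq_unsum => I J _; first exact: (Fl [::]).
  by rewrite (Fr I [::]) sgD xz yz (sg_morph hD).
rewrite hD addrACA; congr (_ + _); apply: IH => *.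
- exact: (Fl (_ :: _)).
- exact: Fr.
- by rewrite Fl !par_word_cat /= sgD xz yz (sg_morph hD).
- by rewrite (Fr _ (_ :: _)) sgD (sg_morph hD).
Qed.

End Unshuffle.

(** * Gerstenhaber algebras *)

Definition oddi (d : int) : bool := odd `|d|%N.

Lemma oddiD a b : oddi (a + b) = oddi a (+) oddi b.
Proof. by rewrite /oddi; lia. Qed.

Lemma oddiB1 a : oddi (a - 1) = ~~ oddi a.
Proof. by rewrite oddiD addbT. Qed.

(** The signs are those of a Lie bracket for the degree shifted by one; the shifted
    degree of [x] is odd exactly when [~~ oddi] holds of its degree. *)
Record almost_gerstenhaber (V : pzRingType) (G : int -> V -> Prop)
    (br : V -> V -> V) : Prop := AlmostGerstenhaber {
  gerst0 : forall d, G d 0;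
  gerstD : forall d x y, G d x -> G d y -> G d (x + y);
  gerstN : forall d x, G d x -> G d (- x);
  gerst1 : G 0 1;
  gerst_mul : forall a b x y, G a x -> G b y -> G (a + b) (x * y);
  gerst_br : forall a b x y, G a x -> G b y -> G (a + b - 1) (br x y);
  gerst_mulC : forall a b x y, G a x -> G b y ->
    x * y = sg (oddi a && oddi b) (y * x);
  gerst_brDl : forall x y z, br (x + y) z = br x z + br y z;
  gerst_brDr : forall x y z, br x (y + z) = br x y + br x z;
  gerst_brC : forall a b x y, G a x -> G b y ->
    br x y = - sg (~~ oddi a && ~~ oddi b) (br y x);
  gerst_brM : forall a b c x y z, G a x -> G b y -> G c z ->
    br (x * y) z = x * br y z + sg (oddi b && ~~ oddi c) (br x z * y) }.

(** The Jacobi identity in Leibniz form: bracketing with [z] on the right is a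
    derivation of the bracket. Its signs depend on the degrees [b] and [c] of [y]
    and [z]. *)
Definition jacobi (V : zmodType) (br : V -> V -> V) (b c : int) (x y z : V) :=
  br (br x y) z = br x (br y z) + sg (~~ oddi b && ~~ oddi c) (br (br x z) y).

Record gerstenhaber (V : pzRingType) (G : int -> V -> Prop) (br : V -> V -> V) :
    Prop := Gerstenhaber {
  gerst_almost :> almost_gerstenhaber G br;
  gerst_jacobi : forall a b c x y z, G a x -> G b y -> G c z ->
    jacobi br b c x y z }.

Section JacobiClosure.
Variables (V : pzRingType) (G : int -> V -> Prop) (br : V -> V -> V).
Hypothesis H : almost_gerstenhaber G br.

Lemma br_sgl b x y : br (sg b x) y = sg b (br x y).
Proof. by apply: (@sg_morph _ _ (br^~ y)) => ? ?; apply: (gerst_brDl H). Qed.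

Lemma br_sgr b x y : br x (sg b y) = sg b (br x y).
Proof. by apply: (@sg_morph _ _ (br x)) => ? ?; apply: (gerst_brDr H). Qed.

Lemma br0l x : br 0 x = 0.
Proof. by apply: (addrI (br 0 x)); rewrite -(gerst_brDl H) !addr0. Qed.

Lemma jacobiD b c x x' y z :
  jacobi br b c x y z -> jacobi br b c x' y z -> jacobi br b c (x + x') y z.
Proof.
by rewrite /jacobi !(gerst_brDl H) => -> ->; rewrite sgD addrACA.
Qed.

Lemma jacobi_swap23 b c x y z : jacobi br b c x y z ->
  G b y -> G c z -> jacobi br c b x z y.
Proof.
move=> J yb zc; rewrite /jacobi [in RHS]J (gerst_brC H zc yb) -[- sg _ _]/(sg true _) sgM.
by rewrite br_sgr sgD sgM addrA sgDNE ?add0r; parity.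
Qed.

Lemma jacobi_swap12 a b c x y z : jacobi br b c x y z ->
  G a x -> G b y -> G c z -> jacobi br a c y x z.
Proof.
move=> J xa yb zc; rewrite /jacobi.
rewrite [br y x](gerst_brC H yb xa) (gerst_brC H (gerst_br H yb zc) xa).
rewrite (gerst_brC H yb (gerst_br H xa zc)) -![- sg _ _]/(sg true _).
rewrite !sgM br_sgl J !sgD !sgM !oddiB1 !oddiD addrC.
by congr (sg _ _ + sg _ _); parity.
Qed.

(** Both sides of the identity are derivations in [x] up to the mixed terms
    [br x z * br x' y] and [br x y * br x' z], which occur on both sides with the
    same signs. *)
Lemma jacobiM a a' b c x x' y z :
  G a x -> G a' x' -> G b y -> G c z ->
  jacobi br b c x y z -> jacobi br b c x' y z -> jacobi br b c (x * x') y z.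
Proof.
move=> xa xa' yb zc J J'; rewrite /jacobi.
have yz := gerst_br H yb zc; have xy := gerst_br H xa yb.
have xy' := gerst_br H xa' yb; have xz := gerst_br H xa zc.
have xz' := gerst_br H xa' zc.
rewrite (gerst_brM H xa xa' yb) (gerst_brM H xa xa' zc) (gerst_brM H xa xa' yz).
rewrite !(gerst_brDl H) !br_sgl (gerst_brM H xa xy' zc) (gerst_brM H xa xz' yb).
rewrite (gerst_brM H xy xa' zc) (gerst_brM H xz xa' yb) J J'.
rewrite !(sgD, mulrDl, mulrDr, sgMl, sgMr) !sgM !oddiB1 !oddiD.
rewrite [LHS](AC (3*(1*2)) (1*5*(2*4*(3*6)))) /=.
by congr (_ + sg _ _ + (_ + sg _ _ + (sg _ _ + sg _ _))); parity.
Qed.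

End JacobiClosure.

(** * Higher brackets of a Gerstenhaber algebra *)

Section GerstenhaberBrackets.
Variables (V : pzRingType) (G : int -> V -> Prop) (br : V -> V -> V).
Hypothesis H : gerstenhaber G br.
Hypothesis torsion2 : forall x : V, x + x = 0 -> x = 0.

Notation entry := (int * V)%type.
Implicit Types (e : entry) (w I J K : seq entry).

Definition epar e := oddi e.1.
Definition ehom e := G e.1 e.2.
Notation hom := (List.Forall ehom).
Notation pw := (par_word epar).
Notation usum := (unsum epar).

Definition wdeg w : int := \sum_(e <- w) e.1.

Lemma wdeg_cons e w : wdeg (e :: w) = e.1 + wdeg w.
Proof. exact: big_cons. Qed.

Lemma oddi_wdeg w : oddi (wdeg w) = pw w.
Proof.
by elim: w => [|e w IH]; rewrite /wdeg ?big_nil // big_cons oddiD -/(wdeg w) IH.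
Qed.

Lemma unshuffle_wdeg w I J : unshuffle w I J -> wdeg w = wdeg I + wdeg J.
Proof.
elim=> [|e {}w {}I {}J _ IH|e {}w {}I {}J _ IH]; first by rewrite /wdeg !big_nil.
  by rewrite !wdeg_cons IH addrA.
by rewrite !wdeg_cons IH addrCA.
Qed.

Lemma sg_hom b d x : G d x -> G d (sg b x).
Proof. by case: b => //; exact: gerstN H _ _. Qed.

Lemma unsum_hom d w (F : seq entry -> seq entry -> V) :
  (forall I J, unshuffle w I J -> G d (F I J)) -> G d (usum w F).
Proof.
elim: w F => [|e w IH] F hF /=; first by apply: hF; constructor.
apply: (gerstD H); apply: IH => I J wIJ; last apply: sg_hom.
  by apply: hF; constructor.
by apply: hF; constructor.
Qed.

(** The bracket B of the introduction; [b] is the parity of [x]. *)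
Definition odot (b : bool) (x y : V) : V := sg b (br y x).

Arguments odot : simpl never.

(** The product in reverse order of the entries, as in the n-bracket. *)
Definition rprod w : V := foldr (fun e p => p * e.2) 1 w.

Definition odot2 w : V :=
  if w is [:: e1; e2] then odot (epar e1) e1.2 e2.2 else 0.

Definition odot1 b x w : V := if w is [:: e] then odot b x e.2 else 0.

(** The n-bracket of the entries of the list: [odot2 I] selects the splittings in
    which [I] has two elements. *)
Definition word_bracket w : V := usum w (fun I J => rprod J * odot2 I).

Lemma odotDl b : forall x y z, odot b (x + y) z = odot b x z + odot b y z.
Proof. by move=> x y z; rewrite /odot (gerst_brDr H) sgD. Qed.

Lemma odotDr b : forall x y z, odot b x (y + z) = odot b x y + odot b x z.
Proof. by move=> x y z; rewrite /odot (gerst_brDl H) sgD. Qed.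

Lemma odot0l b x : odot b 0 x = 0.
Proof. by apply: (addrI (odot b 0 x)); rewrite -odotDl !addr0. Qed.

Lemma odot_sgl b c x y : odot b (sg c x) y = sg c (odot b x y).
Proof. by apply: (@sg_morph _ _ (fun x => odot b x y)) => ? ?; apply: odotDl. Qed.

Lemma odot_hom a b c x y : G a x -> G b y -> G (a + b - 1) (odot c x y).
Proof. by move=> xa yb; rewrite addrC [_ + b]addrC addrC; apply/sg_hom/(gerst_br H). Qed.

Lemma odotC a b x y : G a x -> G b y ->
  odot (oddi a) x y = sg (oddi a && oddi b) (odot (oddi b) y x).
Proof.
move=> xa yb; rewrite /odot (gerst_brC H yb xa) sgN !sgM; congr sg; parity.
Qed.

Lemma odotMr a b c x y z : G a x -> G b y -> G c z ->
  odot (oddi a) x (z * y) =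
    z * odot (oddi a) x y + sg (oddi b && ~~ oddi a) (odot (oddi a) x z * y).
Proof.
move=> xa yb zc; rewrite /odot (gerst_brM H zc yb xa) sgD sgMr sgMl !sgM.
by rewrite [_ (+) oddi a]addbC.
Qed.

Lemma odotMl a b c x y z : G a x -> G b y -> G c z ->
  odot (oddi (a + b)) (y * x) z =
    sg (oddi a) (odot (oddi b) y z * x) +
    sg (oddi b && oddi c) (y * odot (oddi a) x z).
Proof.
move=> xa yb zc; have yx : G (a + b) (y * x) by rewrite addrC; apply: (gerst_mul H).
rewrite (odotC yx zc) (odotMr zc xa yb) (odotC zc xa) (odotC zc yb) oddiD.
by rewrite sgD sgMr sgMl !sgM addrC; congr (sg _ _ + sg _ _); parity.
Qed.

Lemma rprod_hom w : hom w -> G (wdeg w) (rprod w).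
Proof.
elim: w => [|e w IH] /=; first by rewrite /wdeg big_nil => _; apply: (gerst1 H).
move=> /List.Forall_cons_iff [he hw]; rewrite wdeg_cons addrC.
exact: (gerst_mul H (IH hw) he).
Qed.

Lemma odot2_hom w : hom w -> G (wdeg w - 1) (odot2 w).
Proof.
case: w => [|e1 [|e2 [|e3 w]]] /=; try by move=> _; apply: (gerst0 H).
move=> /List.Forall_cons_iff [h1 /List.Forall_cons_iff [h2 _]].
by rewrite /wdeg !big_cons big_nil addr0; apply: odot_hom.
Qed.

Lemma word_bracket_hom w : hom w -> G (wdeg w - 1) (word_bracket w).
Proof.
move=> hw; apply: unsum_hom => I J wIJ.
have [hI hJ] := unshuffle_forall wIJ hw.
rewrite (unshuffle_wdeg wIJ) addrAC addrC.
exact: (gerst_mul H (rprod_hom hJ) (odot2_hom hI)).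
Qed.

Lemma mulDl_morph (y : V) : {morph (fun x => x * y) : x x' / x + x'}.
Proof. by move=> ? ?; apply: mulrDl. Qed.

Lemma mulDr_morph (y : V) : {morph (fun x => y * x) : x x' / x + x'}.
Proof. by move=> ? ?; apply: mulrDr. Qed.

(** Either [e] enters the bracket B together with one other entry, or it is a factor
    of the product; in that case it is moved to the end. *)
Lemma word_bracket_cons e J : ehom e -> hom J ->
  word_bracket (e :: J) =
    usum J (fun J1 J2 => rprod J2 * odot1 (epar e) e.2 J1) +
    sg (epar e) (word_bracket J * e.2).
Proof.
move=> he hJ; rewrite {1}/word_bracket /=; congr (_ + _).
rewrite /word_bracket (unsum_morph _ _ _ (@mulDl_morph e.2)) unsum_sg.
apply: eq_unsum => I K JIK.
have [hI _] := unshuffle_forall JIK hJ.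
rewrite -!mulrA (gerst_mulC H he (odot2_hom hI)) sgMr sgM; congr sg.
by rewrite oddiB1 oddi_wdeg /epar; parity.
Qed.

(** B is a derivation in its second argument, hence B(x, -) of a product is the sum
    over its factors. *)
Lemma odot_rprod a x w : G a x -> hom w ->
  odot (oddi a) x (rprod w) =
  usum w (fun J I => rprod I * odot1 (oddi a) x J).
Proof.
move=> xa; elim: w => [|e w IH] /=.
  move=> _; have := odotMr xa (gerst1 H) (gerst1 H).
  rewrite !mul1r mulr1 /= => E.
  by apply: (addrI (odot (oddi a) x 1)); rewrite addr0 -E.
move=> /List.Forall_cons_iff [he hw].
rewrite (odotMr xa he (rprod_hom hw)) (IH hw); congr (_ + _).
  rewrite -(unsum_left_nil epar w (fun J => rprod J * odot (oddi a) x e.2)).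
  by apply: eq_unsum => I J _; case: I => [|e1 I] //=; rewrite mulr0.
rewrite (unsum_morph _ _ _ (@mulDl_morph e.2)) unsum_sg.
apply: eq_unsum => I J wIJ; have [hI _] := unshuffle_forall wIJ hw.
case: I hI {wIJ} => [|e1 [|e2 I]] hI /=; rewrite ?(mulr0, mul0r, sg0) //.
have [h1 _] := proj1 (List.Forall_cons_iff _ _ _) hI.
rewrite -!mulrA (gerst_mulC H he (odot_hom _ xa h1)) sgMr sgM; congr sg.
by rewrite oddiB1 oddiD /epar; parity.
Qed.

Lemma odot1D b J : {morph (fun x => odot1 b x J) : x y / x + y}.
Proof. by move=> x y; case: J => [|e [|e' J]] /=; rewrite ?addr0 ?odotDl. Qed.

Lemma odot1M a b x y J : G a x -> G b y -> hom J ->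
  odot1 (oddi a (+) oddi b) (y * x) J =
    sg (oddi a) (odot1 (oddi b) y J * x) +
    sg (oddi b && pw J) (y * odot1 (oddi a) x J).
Proof.
move=> xa yb; case: J => [|e [|e' J]] hJ /=; rewrite ?(mulr0, mul0r, sg0, addr0) //.
have [he _] := proj1 (List.Forall_cons_iff _ _ _) hJ.
by rewrite -oddiD (odotMl xa yb he) addbF.
Qed.

(** The polarization of B(x^n / n!, x) = 2 B(x, x) / 2 . x^(n-1) / (n-1)!: each pair
    of entries occurs twice, once for each choice of the entry that stands alone. *)
Lemma odot_rprod_sum w : hom w ->
  usum w (fun I J => odot1 (pw I) (rprod I) J) = word_bracket w + word_bracket w.
Proof.
elim: w => [|e w IH]; first by rewrite /word_bracket /= mulr0 addr0.
move=> hew; have [he hw] := proj1 (List.Forall_cons_iff _ _ _) hew.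
rewrite (word_bracket_cons he hw) [RHS]addrACA -sgD -mulrDl -(IH hw) /=.
have -> : usum w (fun I J => odot1 (epar e (+) pw I) (rprod I * e.2) J) =
    sg (epar e) (usum w (fun I J => odot1 (pw I) (rprod I) J) * e.2) +
    usum w (fun J I => rprod I * odot1 (epar e) e.2 J).
  rewrite [X in _ = _ + X]unsum_cocomm (unsum_morph _ _ _ (@mulDl_morph e.2)).
  rewrite unsum_sg -unsumD; apply: eq_unsum => I J wIJ.
  have [hI hJ] := unshuffle_forall wIJ hw.
  by rewrite -oddi_wdeg (odot1M he (rprod_hom hI) hJ).
rewrite [RHS]addrC [RHS]addrA; congr (_ + _ + _).
rewrite -(odot_rprod he hw) (odotC he (rprod_hom hw)) oddi_wdeg.
rewrite -(unsum_right_nil epar w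
  (fun I => sg (oddi e.1 && pw I) (odot (pw I) (rprod I) e.2))).
by apply: eq_unsum => I J _; case: J => [|e' J] //=; rewrite sg0.
Qed.

(** The square of the odd element [f]: exchanging the two blocks changes the sign of
    every term, so the sum is equal to its opposite. *)
Lemma odd_square0 w (f : seq entry -> V) :
  (forall I, hom I -> G (wdeg I - 1) (f I)) -> hom w ->
  usum w (fun I J => sg (~~ pw I) (f J * f I)) = 0.
Proof.
move=> hf hw; apply: torsion2; rewrite {1}unsum_cocomm -unsumD.
apply: unsum0 => I J wIJ; have [hI hJ] := unshuffle_forall wIJ hw.
rewrite (gerst_mulC H (hf I hI) (hf J hJ)) !oddiB1 !oddi_wdeg !sgM.
by rewrite addrC -[RHS](sgDN (~~ pw I) (f J * f I)); congr (_ + sg _ _); parity.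
Qed.

(** The Jacobi identity of the bracket in terms of B. The three terms are those of
    the three unshuffles of (x, y, z) into a pair and a single element. *)
Lemma odot_jacobi a b c x y z : G a x -> G b y -> G c z ->
  odot (~~ (oddi a (+) oddi b)) (odot (oddi a) x y) z +
  sg (oddi b && oddi c) (odot (~~ (oddi a (+) oddi c)) (odot (oddi a) x z) y) +
  sg (oddi a && (oddi b (+) oddi c))
    (odot (~~ (oddi b (+) oddi c)) (odot (oddi b) y z) x) = 0.
Proof.
move=> xa yb zc; have xy := gerst_br H xa yb; have xz := gerst_br H xa zc.
rewrite !odot_sgl /odot (gerst_brC H yb xa) (gerst_brC H zc xa) (gerst_brC H zc yb).
have brN u v : br u (- v) = - br u v.
  by apply: (@sg_morph _ _ (br u) _ true) => ? ?; apply: (gerst_brDr H).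
have brsg b' u v : br u (sg b' v) = sg b' (br u v).
  by apply: (@sg_morph _ _ (br u)) => ? ?; apply: (gerst_brDr H).
rewrite !brN !brsg (gerst_brC H zc xy) (gerst_brC H yb xz) (gerst_jacobi H xa yb zc).
rewrite !oddiB1 !oddiD !sgN !(sgN, sgD, sgM, opprD).
set P := br x _; set Q := br _ y.
rewrite -[_ + _ + sg _ _ + sg _ _]addrA [sg _ Q + sg _ P]addrC addrACA.
rewrite !sgDNE ?addr0 //; parity.
Qed.

Lemma odot_jacobi_word w : hom w ->
  usum w (fun I J => odot1 (~~ pw I) (odot2 I) J) = 0.
Proof.
move=> hw; have [w3|w3] := eqVneq (size w) 3; last first.
  apply: unsum0 => I J /unshuffle_size IJ.
  case: J IJ => [|e [|e' J]] //= IJ; case: I IJ => [|e1 [|e2 [|e3 I]]] //= IJ;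
    rewrite ?odot0l //.
  by move: w3; rewrite -IJ.
case: w w3 hw => [|e1 [|e2 [|e3 [|e4 w]]]] //= _.
move=> /List.Forall_cons_iff [h1 /List.Forall_cons_iff [h2 /List.Forall_cons_iff [h3 _]]].
rewrite !(odot0l, sg0, add0r, addr0) !(addbF, andbF) /=.
exact: (odot_jacobi h1 h2 h3).
Qed.

(** The polarization of B(B(x, x) . x^k, x) = 0. The derivation property yields the
    terms B(x, x) . B(x^k, x), which contain a square of the odd element B(x, x) by
    [odot_rprod_sum], and the terms B(B(x, x), x) . x^k. *)
Lemma odot_word_bracket w : hom w ->
  usum w (fun I J => odot1 (~~ pw I) (word_bracket I) J) = 0.
Proof.
move=> hw.
transitivity
 (usum w (fun I J => usum I (fun I1 I2 =>
      sg (~~ pw I1) (odot1 (pw I2) (rprod I2) J * odot2 I1))) +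
  usum w (fun I J => usum I (fun I1 I2 =>
      sg (pw I2 && pw J) (rprod I2 * odot1 (~~ pw I1) (odot2 I1) J)))).
  rewrite -unsumD; apply: eq_unsum => I J wIJ.
  have [hI hJ] := unshuffle_forall wIJ hw.
  rewrite (unsum_morph _ _ _ (@odot1D _ J)) -unsumD; apply: eq_unsum => I1 I2 II.
  have [hI1 hI2] := unshuffle_forall II hI.
  rewrite (unshuffle_par _ II) -addNb -!oddi_wdeg -oddiB1.
  by rewrite (odot1M (odot2_hom hI1) (rprod_hom hI2) hJ) !oddi_wdeg.
(* Regroup so that [B(x^k, x)], then [B(x, x) . B(x, x)], are inner sums. *)
rewrite unsum_coassoc [X in _ + X]unsum_coassoc.
have -> : usum w (fun I1 L => usum L (fun I2 J =>
      sg (~~ pw I1) (odot1 (pw I2) (rprod I2) J * odot2 I1))) =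
   usum w (fun I1 L => sg (~~ pw I1) (word_bracket L * odot2 I1)) +
   usum w (fun I1 L => sg (~~ pw I1) (word_bracket L * odot2 I1)).
  rewrite -unsumD; apply: eq_unsum => I L wIL.
  have [hI hL] := unshuffle_forall wIL hw.
  by rewrite -unsum_sg -(unsum_morph _ _ _ (@mulDl_morph _)) odot_rprod_sum // mulrDl sgD.
have -> : usum w (fun I1 L => sg (~~ pw I1) (word_bracket L * odot2 I1)) = 0.
  transitivity (usum w (fun I1 L => usum L (fun I2 J =>
      rprod J * sg (~~ pw I1) (odot2 I2 * odot2 I1)))).
    apply: eq_unsum => I L _; rewrite (unsum_morph _ _ _ (@mulDl_morph _)) unsum_sg.
    by apply: eq_unsum => I2 J _; rewrite sgMr mulrA.
  rewrite -unsum_coassoc; apply: unsum0 => I J wIJ.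
  have [hI hJ] := unshuffle_forall wIJ hw.
  rewrite -(unsum_morph _ _ _ (@mulDr_morph _)) odd_square0 ?mulr0 //.
  exact: odot2_hom.
(* In the remaining terms the single entry is moved next to the pair. *)
rewrite !add0r.
transitivity (usum w (fun I1 L => usum L (fun J I2 =>
   rprod I2 * odot1 (~~ pw I1) (odot2 I1) J))).
  apply: eq_unsum => I L _; rewrite unsum_cocomm.
  by apply: eq_unsum => J I2 _; rewrite sgM andbC addbb.
rewrite -unsum_coassoc; apply: unsum0 => I J wIJ.
have [hI hJ] := unshuffle_forall wIJ hw.
by rewrite -(unsum_morph _ _ _ (@mulDr_morph _)) odot_jacobi_word ?mulr0.
Qed.

(** By [word_bracket_cons] the inner bracket, as an entry of the outer one, is either
    an argument of B or a factor. The latter terms form the square of the odd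
    element [word_bracket], the former contain the sum of [odot_word_bracket]. *)
Theorem word_bracket_jacobi w : hom w ->
  usum w (fun I J => word_bracket ((wdeg I - 1, word_bracket I) :: J)) = 0.
Proof.
move=> hw.
under eq_unsum => I J wIJ.
  have [hI hJ] := unshuffle_forall wIJ hw.
  rewrite word_bracket_cons // /ehom /=; last exact: word_bracket_hom.
  rewrite /epar /= oddiB1 oddi_wdeg; over.
rewrite unsumD (odd_square0 word_bracket_hom hw) addr0 -unsum_coassoc.
apply: unsum0 => I J wIJ; have [hI hJ] := unshuffle_forall wIJ hw.
by rewrite -(unsum_morph _ _ _ (@mulDr_morph _)) odot_word_bracket ?mulr0.
Qed.

Lemma rprod_cat w w' : rprod (w ++ w') = rprod w' * rprod w.
Proof. by elim: w => [|e w IH] /=; rewrite ?mulr1 // IH mulrA. Qed.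

Lemma word_bracket_swap u e1 e2 v : ehom e1 -> ehom e2 ->
  word_bracket (u ++ e1 :: e2 :: v) =
  sg (epar e1 && epar e2) (word_bracket (u ++ e2 :: e1 :: v)).
Proof.
move=> h1 h2; apply: unsum_swap => [u' v' J|I u' v'].
  rewrite -sgMr; congr (_ * _).
  case: u' => [|f [|f' u']]; case: v' => [|f1 v'] /=; rewrite ?sg0 //.
    exact: odotC.
  1,2: by case: u' => [|? ?] /=; rewrite sg0.
rewrite -sgMl !rprod_cat /= -!mulrA [e2.2 * _]mulrA (gerst_mulC H h2 h1).
by rewrite andbC !(sgMl, sgMr) !mulrA.
Qed.

(** Additivity in one slot, together with homogeneity for any operator [h] that is
    central for the product and the bracket; scalar multiplications by real numbers
    are such operators, those by elements of the algebra in general are not. *)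
Lemma word_bracket_slot (h : V -> V) d x y u v :
  {morph h : a b / a + b} ->
  (forall a b, h (a * b) = h a * b) -> (forall a b, h (a * b) = a * h b) ->
  (forall a b, br (h a) b = h (br a b)) -> (forall a b, br a (h b) = h (br a b)) ->
  word_bracket (u ++ (d, h x + y) :: v) =
    h (word_bracket (u ++ (d, x) :: v)) + word_bracket (u ++ (d, y) :: v).
Proof.
move=> hD hMl hMr hbl hbr; apply: unsum_slot => // [u' v' J|I u' v'].
  have h0 : h 0 = 0 by apply: (addrI (h 0)); rewrite -hD !addr0.
  rewrite hMr -mulrDr; congr (_ * _).
  case: u' => [|f [|f' u']]; case: v' => [|f1 [|f2 v']] /=; rewrite ?h0 ?addr0 //.
  - by rewrite odotDl /odot hbr (sg_morph hD).
  - by rewrite odotDr /odot hbl (sg_morph hD).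
  - by case: u' => [|? ?] /=; rewrite h0 addr0.
  - by case: u' => [|? ?] /=; rewrite h0 addr0.
  - by case: u' => [|? ?] /=; rewrite h0 addr0.
by rewrite !rprod_cat /= mulrDr !mulrDl -hMr -!hMl.
Qed.

End GerstenhaberBrackets.

(** * Shuffle permutations *)

Lemma take_enum_ord n k : take k (enum 'I_n) = [seq i : 'I_n <- enum 'I_n | (i < k)%N].
Proof.
apply: (inj_map val_inj); rewrite map_take val_enum_ord.
rewrite -(filter_map val (fun i => i < k)%N) val_enum_ord take_iota.
have [kn|nk] := leqP k n; first exact/esym/filter_iota_ltn.
apply/esym/all_filterP/allP => i; rewrite mem_iota => /andP [_ ik].
exact: leq_trans ik (ltnW nk).
Qed.

Lemma enum_ord_lift n (k : 'I_n.+1) :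
  enum 'I_n.+1 =
  map (lift k) (take k (enum 'I_n)) ++ k :: map (lift k) (drop k (enum 'I_n)).
Proof.
apply: (inj_map val_inj); rewrite map_cat /= val_enum_ord -!map_comp.
have E : val \o lift k =1 bump k \o val by [].
have kn : (k <= n)%N by rewrite -ltnS.
have Et : map val (take k (enum 'I_n)) = iota 0 k.
  by rewrite map_take val_enum_ord take_iota (minn_idPl kn).
have Ed : map val (drop k (enum 'I_n)) = iota k (n - k).
  by rewrite map_drop val_enum_ord drop_iota.
rewrite !(eq_map E) !map_comp Et Ed.
have -> : map (bump k) (iota 0 k) = iota 0 k.
  rewrite -[RHS]map_id; apply/eq_in_map => i; rewrite mem_iota /= add0n => ik.
  by rewrite /bump leqNgt ik.
have -> : map (bump k) (iota k (n - k)) = iota k.+1 (n - k).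
  rewrite -(add1n k) iotaDl; apply/eq_in_map => i.
  by rewrite mem_iota => /andP [ki _]; rewrite /bump ki.
by rewrite -{1}(subnKC (leqW kn)) iotaD add0n subSn //= addn0.
Qed.

Lemma ltn_bump h a b : (bump h a < bump h b)%N = (a < b)%N.
Proof. by rewrite /bump; case: (leqP h a); case: (leqP h b) => /=; lia. Qed.

Lemma ltn_bump_self h a : (bump h a < h)%N = (a < h)%N.
Proof. by rewrite /bump; case: (leqP h a) => /=; lia. Qed.

Section ShuffleSums.
Variables (T : Type) (par : T -> bool).

Definition ord_word n (e : 'I_n -> T) : seq T := [seq e i | i <- enum 'I_n].

Lemma size_ord_word n (e : 'I_n -> T) : size (ord_word e) = n.
Proof. by rewrite size_map size_enum_ord. Qed.

Lemma ord_word_nat n (f : nat -> T) :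
  ord_word (fun i : 'I_n => f i) = [seq f i | i <- iota 0 n].
Proof. by rewrite /ord_word -val_enum_ord -map_comp. Qed.

Lemma ord_word_take n p (f : 'I_n.+1 -> T) : (p <= n.+1)%N ->
  take p (ord_word f) = ord_word (fun i : 'I_p => f (inord i)).
Proof.
move=> pn; rewrite (ord_word_nat p (fun i => f (inord i))).
have -> : ord_word f = [seq f (inord i) | i <- iota 0 n.+1].
  by rewrite -ord_word_nat; apply: eq_map => i; rewrite inord_val.
by rewrite -map_take take_iota (minn_idPl pn).
Qed.

Lemma ord_word_drop n p (f : 'I_n.+1 -> T) :
  drop p (ord_word f) = ord_word (fun i : 'I_(n.+1 - p) => f (inord (p + i))).
Proof.
rewrite (ord_word_nat _ (fun i => f (inord (p + i)))).
have -> : ord_word f = [seq f (inord i) | i <- iota 0 n.+1].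
  by rewrite -ord_word_nat; apply: eq_map => i; rewrite inord_val.
by rewrite -map_drop drop_iota add0n -[p in iota p _]addn0 iotaDl -map_comp.
Qed.

Lemma ord_word_lift n (e : 'I_n.+1 -> T) (k : 'I_n.+1) (u : 'S_n) :
  let w := ord_word (fun i => e (lift ord0 (u i))) in
  ord_word (fun i => e (lift_perm k ord0 u i)) = take k w ++ e ord0 :: drop k w.
Proof.
have E s : [seq e (lift_perm k ord0 u i) | i <- map (lift k) s] =
           [seq e (lift ord0 (u i)) | i <- s].
  by elim: s => //= i s ->; rewrite lift_perm_lift.
rewrite /ord_word /= [in LHS](enum_ord_lift k) map_cat /= lift_perm_id !E.
by rewrite map_take map_drop.
Qed.

Lemma ord_word_cons n (e : 'I_n.+1 -> T) :
  ord_word e = e ord0 :: ord_word (fun i => e (lift ord0 i)).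
Proof. by rewrite /ord_word enum_ordSl /=; congr cons; elim: (enum _) => //= i s ->. Qed.

(** The permutation brings the first argument to position [k], across the [k]
    arguments that now precede it. *)
Lemma koszul_lift n (e : 'I_n.+1 -> T) (d : 'I_n.+1 -> int) (k : 'I_n.+1) (u : 'S_n) :
  (forall i, par (e i) = oddi (d i)) ->
  koszul d (lift_perm k ord0 u) =
    koszul (fun i => d (lift ord0 i)) u *
    (-1) ^+ (par (e ord0) &&
      par_word par (take k (ord_word (fun i => e (lift ord0 (u i)))))).
Proof.
move=> ed; rewrite /koszul (bigD1_ord k) //= lift_perm_id big_pred0 ?mul1r; last first.
  by move=> j; rewrite ltn0 andbF.
transitivity (\prod_(i < n)
  ((\prod_(j < n | (i < j)%N && (u j < u i)%N)
     (-1) ^+ (`|d (lift ord0 (u i))| * `|d (lift ord0 (u j))|)%N) *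
   (if (i < k)%N then (-1) ^+ (oddi (d ord0) && oddi (d (lift ord0 (u i)))) else 1)
   : int)).
  apply: eq_bigr => i _; rewrite big_mkcond (bigD1_ord k) //= lift_perm_id.
  rewrite mulrC lift_perm_lift; congr (_ * _).
    rewrite [RHS]big_mkcond; apply: eq_bigr => j _.
    by rewrite lift_perm_lift /= !ltn_bump.
  rewrite /= /bump leq0n add1n ltn0Sn andbT.
  have -> : (((k <= i) + i)%N < k)%N = (i < k)%N by case: (leqP k i) => /=; lia.
  case: ifP => // _; rewrite -signr_odd oddM /oddi andbC //.
rewrite big_split /=; congr (_ * _).
rewrite -big_mkcond /ord_word -map_take take_enum_ord.
transitivity (\prod_(i <- enum 'I_n | (i < k)%N)
  (-1) ^+ (oddi (d ord0) && oddi (d (lift ord0 (u i)))) : int).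
  by rewrite big_enum_cond.
rewrite -big_filter /=.
elim: [seq _ <- _ | _] => [|i r IH] /=; first by rewrite big_nil andbF.
by rewrite big_cons IH -signr_addb !ed -andb_addr.
Qed.

Lemma lift_perm_bij n :
  bijective (fun z : 'I_n.+1 * 'S_n => lift_perm z.1 ord0 z.2).
Proof.
apply: inj_card_bij; last by rewrite card_prod !card_Sn card_ord factS.
case=> [k u] [k' u'] /= E; have kk : k = k'.
  apply: (@perm_inj _ (lift_perm k' ord0 u')).
  by rewrite -[in LHS]E !lift_perm_id.
subst k'; congr pair; apply/permP => i; apply: (@lift_inj _ ord0).
by rewrite -(lift_perm_lift k) E lift_perm_lift.
Qed.

Lemma sum_lift_perm (M : zmodType) n (f : 'S_n.+1 -> M) :
  \sum_s f s = \sum_(k < n.+1) \sum_(u : 'S_n) f (lift_perm k ord0 u).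
Proof.
rewrite pair_big /=; apply: (reindex (fun z => lift_perm z.1 ord0 z.2)).
exact/onW_bij/lift_perm_bij.
Qed.

(** The smallest value 0 of a shuffle is taken at the start of one of the two
    increasing blocks, that is at position 0 or at position [p]. *)
Lemma shuffle_lift p n (k : 'I_n.+1) (u : 'S_n) :
  shuffle p (lift_perm k ord0 u) =
  [&& k == 0%N :> nat, (0 < p)%N & shuffle p.-1 u] || (k == p :> nat) && shuffle p u.
Proof.
set s := lift_perm k ord0 u.
have s0 j : j != k -> (ord0 < s j)%N.
  by case: (unliftP k j) => [j' ->|->]; rewrite ?eqxx // /s lift_perm_lift.
have sk : s k = ord0 by apply: lift_perm_id.
have sl i j : (s (lift k i) < s (lift k j))%N = (u i < u j)%N.
  by rewrite !lift_perm_lift /= /bump !leq0n !add1n ltnS.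
apply/idP/idP.
  move=> /forallP H.
  have Hl (i j : 'I_n) : (i < j)%N -> (lift k j < p)%N || (p <= lift k i)%N ->
      (u i < u j)%N.
    move=> ij pij; move/forallP: (H (lift k i)) => /(_ (lift k j)) /implyP.
    rewrite sl => -> //; rewrite pij andbT /= /bump.
    by case: (leqP k i); case: (leqP k j); lia.
  have k0 : (k == 0%N :> nat) && (0 < p)%N || (k == p :> nat).
    have [-> //|kp] := eqVneq (k : nat) p; first by rewrite orbT.
    rewrite orbF; have [k0|k0] := eqVneq (k : nat) 0%N; first by lia.
    have [kp'|kp'] := ltnP k p.
      move/forallP: (H ord0) => /(_ k) /implyP; rewrite sk ltn0 => h.
      by exfalso; have: false by apply: h; rewrite /=; lia.
    have pn : (p < n.+1)%N by have := ltn_ord k; lia.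
    move/forallP: (H (Ordinal pn)) => /(_ k) /implyP; rewrite sk ltn0 => h.
    by exfalso; have: false by apply: h; rewrite /=; lia.
  case/orP: k0 => [/andP [/eqP k0 p0]|/eqP kp].
    apply/orP; left; rewrite k0 p0 eqxx /=.
    apply/forallP => i; apply/forallP => j; apply/implyP => /andP [ij pij].
    by apply: Hl => //; rewrite /= /bump k0 !leq0n; lia.
  apply/orP; right; rewrite kp eqxx /=.
  apply/forallP => i; apply/forallP => j; apply/implyP => /andP [ij pij].
  apply: Hl => //; rewrite /= /bump kp.
  by case: (leqP p i); case: (leqP p j); lia.
move=> H; apply/forallP => i; apply/forallP => j; apply/implyP.
case: (unliftP k i) => [i' ->|->]; last first.
  by rewrite sk => /andP [ij _]; apply: s0; rewrite -val_eqE /=; lia.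
case: (unliftP k j) => [j' ->|->]; last first.
  rewrite sk; case/orP: H => [/and3P [/eqP k0 _ _]|/andP [/eqP kp _]].
    by rewrite k0 ltn0.
  by rewrite kp; case/andP => H1; lia.
rewrite sl /= => /andP [ij pij].
have ij' : (i' < j')%N by rewrite -(ltn_bump k).
case/orP: H => [/and3P [/eqP k0 p0 /forallP/(_ i')/forallP/(_ j')/implyP]|
               /andP [/eqP kp /forallP/(_ i')/forallP/(_ j')/implyP]]; apply.
  by rewrite ij' /=; move: pij; rewrite /bump k0 !leq0n; lia.
by rewrite ij' /=; move: pij; rewrite kp ltn_bump_self ![(p <= _)%N]leqNgt ltn_bump_self.
Qed.

(** The two positions of 0 allowed by [shuffle_lift] correspond to the two terms in
    the recursive definition of [unsum]. When [p] is 0 or [n] one of the blocks is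
    empty and the corresponding term vanishes. *)
Lemma sum_shuffle (M : zmodType) n p (e : 'I_n -> T) (d : 'I_n -> int)
    (F : seq T -> seq T -> M) :
  (p <= n)%N -> (forall i, par (e i) = oddi (d i)) ->
  \sum_(s : 'S_n | shuffle p s)
     (let w := ord_word (fun i => e (s i)) in F (take p w) (drop p w)) *~ koszul d s =
  unsum par (ord_word e) (fun I J => if size I == p then F I J else 0).
Proof.
elim: n p e d F => [|n IH] p e d F pn ed.
  rewrite leqn0 in pn; rewrite (eqP pn).
  rewrite (big_pred1 (1%g : 'S_0)) => [|s]; last first.
    rewrite /= (_ : s = 1%g) ?eqxx; last by apply/permP; case.
    by apply/forallP; case.
  by rewrite koszul1 /= /ord_word enum_ord0.
rewrite ord_word_cons /= big_mkcond sum_lift_perm.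
have T1 : \sum_(u : 'S_n) (if (0 < p)%N && shuffle p.-1 u then
      (let w := ord_word (fun i => e (lift_perm ord0 ord0 u i)) in
       F (take p w) (drop p w)) *~ koszul d (lift_perm ord0 ord0 u) else 0) =
   unsum par (ord_word (fun i => e (lift ord0 i)))
     (fun I J => if (size I).+1 == p then F (e ord0 :: I) J else 0).
  case: p pn => [|p] pn; first by rewrite big1 // unsum0.
  rewrite -big_mkcond /=.
  rewrite -(IH _ _ (fun i => d (lift ord0 i)) (fun I => F (e ord0 :: I))) //.
  apply: eq_bigr => u _; rewrite (koszul_lift _ _ ed) take0 andbF mulr1.
  by rewrite ord_word_lift take0 drop0.
have T2 (k : 'I_n.+1) : k = p :> nat ->
  \sum_(u : 'S_n) (if shuffle p u then
      (let w := ord_word (fun i => e (lift_perm k ord0 u i)) in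
       F (take p w) (drop p w)) *~ koszul d (lift_perm k ord0 u) else 0) =
   unsum par (ord_word (fun i => e (lift ord0 i)))
     (fun I J => sg (par (e ord0) && par_word par I)
        (if size I == p then F I (e ord0 :: J) else 0)).
  move=> kp; rewrite -big_mkcond /=; have pn' : (p <= n)%N by rewrite -kp -ltnS.
  transitivity (unsum par (ord_word (fun i => e (lift ord0 i)))
     (fun I J => if size I == p then sg (par (e ord0) && par_word par I)
         (F I (e ord0 :: J)) else 0)); last first.
    by apply: eq_unsum => I J _; case: ifP; rewrite ?sg0.
  rewrite -(IH _ _ (fun i => d (lift ord0 i)) (fun I J =>
    sg (par (e ord0) && par_word par I) (F I (e ord0 :: J)))) //.
  apply: eq_bigr => u _; rewrite (koszul_lift _ _ ed) ord_word_lift kp.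
  set w := ord_word _; have sw : size (take p w) = p.
    by rewrite size_takel // size_ord_word.
  rewrite take_cat drop_cat sw ltnn subnn take0 drop0 cats0 /=.
  rewrite mulrC mulrzA; congr (_ *~ _).
  by case: (_ && _); rewrite ?mulrN1z ?mulr1z.
rewrite -T1.
have [pn'|pn'] := ltnP n p.
  have -> : unsum par (ord_word (fun i => e (lift ord0 i))) (fun I J =>
     sg (par (e ord0) && par_word par I)
        (if size I == p then F I (e ord0 :: J) else 0)) = 0.
    apply: unsum0 => I J /unshuffle_size; rewrite size_ord_word => E.
    by rewrite (_ : _ == _ = false) ?sg0 //; lia.
  rewrite addr0 (bigD1 ord0) //= [X in _ + X]big1 ?addr0 => [|k k0].
    apply: eq_bigr => u _; rewrite shuffle_lift /= (_ : (0 == p) = false) ?orbF //.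
    by lia.
  apply: big1 => u _; rewrite shuffle_lift; have := ltn_ord k.
  move: k0; rewrite -val_eqE /= => /negbTE -> kn.
  by rewrite (_ : _ == p = false) //; lia.
have [p0|p0] := posnP p.
  rewrite -(T2 ord0) ?p0 //= [X in _ = X + _]big1 // add0r.
  rewrite (bigD1 ord0) //= [X in _ + X]big1 ?addr0 => [|k k0].
    by apply: eq_bigr => u _; rewrite shuffle_lift.
  apply: big1 => u _; rewrite shuffle_lift.
  by move: k0; rewrite -val_eqE /= => /negbTE ->.
rewrite -(T2 (Ordinal (_ : p < n.+1)%N)) //.
rewrite (bigD1 ord0) //=; congr (_ + _).
  apply: eq_bigr => u _; rewrite shuffle_lift /= p0 (_ : (0 == p) = false) ?orbF //.
  by lia.
set k := Ordinal _; have kn0 : k != ord0 by rewrite -val_eqE /=; lia.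
rewrite (bigD1 k) //= [X in _ + X]big1 ?addr0.
  apply: eq_bigr => u _; rewrite shuffle_lift /= eqxx (_ : (p == 0%N) = false) //.
  by lia.
move=> j /andP [j0 jk]; apply: big1 => u _; rewrite shuffle_lift.
by move: j0 jk; rewrite -!val_eqE /= => /negbTE -> /negbTE ->.
Qed.

(** The first argument is moved back from its position by exchanges of neighbours,
    and induction applies to the others. *)
Lemma koszul_symmetric (M : zmodType) (P : T -> Prop) n (f : seq T -> M)
    (e : 'I_n -> T) (d : 'I_n -> int) (s : 'S_n) :
  (forall u x y v, P x -> P y ->
     f (u ++ x :: y :: v) = sg (par x && par y) (f (u ++ y :: x :: v))) ->
  (forall i, P (e i)) -> (forall i, par (e i) = oddi (d i)) ->
  f (ord_word e) = f (ord_word (fun i => e (s i))) *~ koszul d s.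
Proof.
move=> fC; elim: n f fC e d s => [|n IH] f fC e d s Pe ed.
  have -> : s = 1%g by apply/permP; case.
  by rewrite koszul1 mulr1z; congr f; apply: eq_map; case.
have [g _ gK] := lift_perm_bij n; rewrite -(gK s); case: (g s) => k u /=.
rewrite ord_word_lift ord_word_cons (koszul_lift _ _ ed) mulrzA mulrz_sign.
rewrite (IH (fun w => f (e ord0 :: w)) _ _ (fun i => d (lift ord0 i)) u) //; last first.
  by move=> u' x y v' Px Py; apply: (fC (_ :: _)).
set w := ord_word _.
have Pw : List.Forall P (take k w).
  rewrite /w /ord_word -map_take; elim: (take k _) => [|i r Pr] /=; by constructor.
have move_e u' v' : List.Forall P u' ->
    f (u' ++ e ord0 :: v') =
      sg (par (e ord0) && par_word par u') (f (e ord0 :: u' ++ v')).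
  elim/last_ind: u' v' => [|u' x IHu] v' Pu; first by rewrite andbF.
  move: Pu; rewrite -cats1 => /List.Forall_app [Pu /List.Forall_cons_iff [Px _]].
  rewrite -!catA /= fC // (IHu _ Pu) sgM par_word_cat /= addbF; congr sg.
  by parity.
rewrite (move_e _ _ Pw) cat_take_drop.
by case: (_ && _) => /=; rewrite ?mulrNz ?opprK // mulNrz opprK.
Qed.

End ShuffleSums.

(** * Homogeneous elements of the exterior algebra *)

Section ExteriorHomogeneous.
Variables (A : comPzRingType) (g : lmodType A).
Implicit Types (p q : ext g) (d : int) (u v w : seq g).

Lemma ext_homog_mon a w : ext_homog (size w) (mon a w).
Proof. by exists [:: (a, w)]; rewrite /= ?eqxx. Qed.

Lemma ext_homog0 d : ext_homog d (0 : ext g).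
Proof. by exists [::]. Qed.

Lemma ext_homogD d p q : ext_homog d p -> ext_homog d q -> ext_homog d (p + q).
Proof.
move=> [s hs ->] [t ht ->]; exists (s ++ t); first by rewrite all_cat hs.
exact/esym/ext_sum_cat.
Qed.

Lemma ext_homog_ind d (P : ext g -> Prop) :
  P 0 -> (forall a w, (size w)%:Z = d -> P (mon a w)) ->
  (forall p q, P p -> P q -> P (p + q)) -> forall p, ext_homog d p -> P p.
Proof.
move=> P0 Pm PD p [s hs ->]; rewrite ext_sumE.
elim: s hs => [|[a w] s IH] /=; first by rewrite big_nil.
by case/andP => /eqP wd hs; rewrite big_cons; apply: PD; [apply: Pm | apply: IH].
Qed.

Lemma ext_homogN d p : ext_homog d p -> ext_homog d (- p).
Proof.
elim/ext_homog_ind => [|a w <-|p' q IHp IHq]; first by rewrite oppr0; apply: ext_homog0.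
  by rewrite -monN; apply: ext_homog_mon.
by rewrite opprD; apply: ext_homogD.
Qed.

Lemma ext_homog_sum d (I : Type) (r : seq I) (P : pred I) (F : I -> ext g) :
  (forall i, P i -> ext_homog d (F i)) -> ext_homog d (\sum_(i <- r | P i) F i).
Proof.
move=> hF; elim/big_rec: _ => [|i p Pi hp]; first exact: ext_homog0.
by apply: ext_homogD => //; apply: hF.
Qed.

Lemma ext_homogM d d' p q :
  ext_homog d p -> ext_homog d' q -> ext_homog (d + d') (p * q).
Proof.
move=> hp hq; elim/ext_homog_ind: p / hp => [|a w <-|p p' hp hp'].
- by rewrite mul0r; apply: ext_homog0.
- elim/ext_homog_ind: q / hq => [|b v <-|q q' hq hq'].
  + by rewrite mulr0; apply: ext_homog0.
  + by rewrite mul_mon -PoszD -size_cat; apply: ext_homog_mon.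
  + by rewrite mulrDr; apply: ext_homogD.
- by rewrite mulrDl; apply: ext_homogD.
Qed.

Lemma ext_homogZ d a p : ext_homog d p -> ext_homog d (a *: p).
Proof.
elim/ext_homog_ind => [|b w <-|p' q IHp IHq]; first by rewrite scaler0; apply: ext_homog0.
  by rewrite scale_mon; apply: ext_homog_mon.
by rewrite scalerDr; apply: ext_homogD.
Qed.

Lemma ext_scaleAl a p q : (a *: p) * q = a *: (p * q).
Proof.
elim/ext_ind: p => [|b u|p p' IH IH']; first by rewrite scaler0 !mul0r scaler0.
  elim/ext_ind: q => [|c v|q q' IH IH']; first by rewrite !mulr0 scaler0.
    by rewrite scale_mon !mul_mon scale_mon mulrA.
  by rewrite !mulrDr scalerDr IH IH'.
by rewrite scalerDr !mulrDl scalerDr IH IH'.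
Qed.

Lemma ext_scaleAr a p q : p * (a *: q) = a *: (p * q).
Proof.
elim/ext_ind: p => [|b u|p p' IH IH']; first by rewrite !mul0r scaler0.
  elim/ext_ind: q => [|c v|q q' IH IH']; first by rewrite !(mulr0, scaler0).
    by rewrite scale_mon !mul_mon scale_mon mulrCA.
  by rewrite scalerDr !mulrDr scalerDr IH IH'.
by rewrite !mulrDl scalerDr IH IH'.
Qed.

Lemma scaler_sg a b p : a *: sg b p = sg b (a *: p).
Proof. by apply: (@sg_morph _ _ ( *:%R a)) => ? ?; apply: scalerDr. Qed.

Lemma mon_scale a w : mon a w = a *: mon 1 w.
Proof. by rewrite scale_mon mulr1. Qed.

Lemma mon_sign (n : nat) a w : mon ((-1) ^+ n * a) w = sg (odd n) (mon a w) :> ext g.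
Proof. by rewrite -signr_odd; case: (odd n); rewrite ?mulN1r ?monN ?mul1r. Qed.

Lemma mon_catC a u v :
  mon a (u ++ v) = sg (odd (size u) && odd (size v)) (mon a (v ++ u)).
Proof.
elim: u v a => [|x u IH] v a /=; first by rewrite cats0.
have -> : mon a (x :: u ++ v) = mon 1 [:: x] * mon a (u ++ v) by rewrite mul_mon mul1r.
rewrite IH sgMr mul_mon mul1r /= mon_move mon_sign sgM; congr sg.
by case: (odd (size u)); case: (odd (size v)).
Qed.

Lemma ext_mulC d d' p q : ext_homog d p -> ext_homog d' q ->
  p * q = sg (oddi d && oddi d') (q * p).
Proof.
move=> hp hq; elim/ext_homog_ind: p / hp => [|a w <-|p p' hp hp'].
- by rewrite mul0r mulr0 sg0.
- elim/ext_homog_ind: q / hq => [|b v <-|q q' hq hq'].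
  + by rewrite mul0r mulr0 sg0.
  + by rewrite !mul_mon mon_catC mulrC.
  + by rewrite mulrDr hq hq' -sgD -mulrDl.
- by rewrite mulrDl hp hp' -sgD -mulrDr.
Qed.

Lemma mon_cat_mul a u v : mon a (u ++ v) = mon a u * mon 1 v :> ext g.
Proof. by rewrite mul_mon mulr1. Qed.

End ExteriorHomogeneous.

(** * The exterior algebra as a Gerstenhaber algebra *)

Section SchoutenNijenhuis.
Variables (R : realType) (A : comPzRingType) (eta : {rmorphism R -> A}).
Variables (g : lmodType A) (L : lie_rinehart eta g).
Implicit Types (a b : A) (x y : g) (u v w X Y : seq g) (p q : ext g).

Lemma anchorZeta x (r : R) a : anchor L x (eta r * a) = eta r * anchor L x a.
Proof.
have E := anchor_lin L x r a 0; rewrite addr0 in E; rewrite E.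
by have := anchor_lin L x 1 0 0; rewrite rmorph1 !mul1r addr0 => /eqP;
  rewrite -subr_eq0 opprD addNKr oppr_eq0 => /eqP ->; rewrite addr0.
Qed.

Lemma vec_vec_symbol_l b X Y :
  - (\sum_(j < size Y) mon ((-1) ^+ j * anchor L Y`_j b) (X ++ omit j Y)) =
  mon 1 X * sn_scal_vec L b Y.
Proof.
rewrite mulr_sumr -sumrN; apply: eq_bigr => j _.
by rewrite mul_mon mul1r exprS mulN1r mulNr monN.
Qed.

Lemma vec_vec_symbol_r b X Y :
  \sum_(i < size X)
    mon ((-1) ^+ (i + size (omit i X)) * anchor L X`_i b) (omit i X ++ Y) =
  sn_vec_scal L X b * mon 1 Y.
Proof.
rewrite mulr_suml; apply: eq_bigr => i _; rewrite mul_mon mulr1 !mon_sign.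
rewrite size_omit //; congr sg; have := ltn_ord i; lia.
Qed.

(** One formula for all monomials, scalars included: for an empty word the terms that
    make no sense are empty sums. The two correction terms arise because the bracket
    is a first order operator, not a linear one, in the coefficients [a] and [b]. *)
Lemma sn_monU a X b Y : sn L (mon a X) (mon b Y) =
  (a * b) *: sn_vec_vec L X Y + a *: (sn_vec_scal L X b * mon 1 Y) +
  b *: (mon 1 X * sn_scal_vec L a Y).
Proof.
rewrite sn_monE.
have vv0 Z : sn_vec_vec L [::] Z = 0 by rewrite /sn_vec_vec big_ord0.
have vv0r Z : sn_vec_vec L Z [::] = 0.
  by rewrite /sn_vec_vec big1 // => i _; rewrite big_ord0.
have vs0 c : sn_vec_scal L [::] c = 0 by rewrite /sn_vec_scal big_ord0.
have sv0 c : sn_scal_vec L c [::] = 0 by rewrite /sn_scal_vec big_ord0.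
case: X => [|x X]; case: Y => [|y Y] /=.
- by rewrite vv0 vs0 sv0 !(mulr0, mul0r, scaler0, addr0).
- rewrite vv0 vs0 !(mulr0, mul0r, scaler0, add0r) mul1r.
  by have := slotZ (slotwise_scal_vec L a) b [::] y Y; rewrite addr0.
- rewrite vv0r sv0 !(mulr0, scaler0, add0r) addr0 mulr1.
  by have := slotZ (slotwise_vec_scal L b) a [::] x X; rewrite addr0.
have := slotZ (slotwise_vec_vec_l L (b *: y :: Y)) a [::] x X.
rewrite vec_vec_symbol_l /= => ->.
have := slotZ (slotwise_vec_vec_r L (x :: X)) b [::] y Y.
rewrite vec_vec_symbol_r /= => ->.
have := slotZ (slotwise_scal_vec L a) b [::] y Y; rewrite addr0 /= => ->.
by rewrite scalerDr scalerA ext_scaleAr.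
Qed.

Lemma sum_omit_cat (N : zmodType) (T : nat -> g -> seq g -> N) X X' :
  \sum_(i < size (X ++ X')) T i (X ++ X')`_i (omit i (X ++ X')) =
  \sum_(i < size X) T i X`_i (omit i X ++ X') +
  \sum_(i < size X') T (size X + i)%N X'`_i (X ++ omit i X').
Proof.
rewrite size_cat big_split_ord /=; congr (_ + _); apply: eq_bigr => i _; rewrite /omit.
  have iX := ltn_ord i; rewrite nth_cat iX take_cat iX drop_cat -catA.
  case: ltnP => // Xi; have -> : i.+1 = size X by lia.
  by rewrite subnn drop0 drop_size.
rewrite nth_cat take_cat drop_cat !ltnNge leq_addr -addnS leq_addr /= !addKn.
by rewrite catA.
Qed.

Lemma vec_vec_catl X X' Y :
  sn_vec_vec L (X ++ X') Y = mon 1 X * sn_vec_vec L X' Y +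
   sg (odd (size X') && ~~ odd (size Y)) (sn_vec_vec L X Y * mon 1 X').
Proof.
have := sum_omit_cat (fun i x W => \sum_(j < size Y)
   mon ((-1) ^+ (i + j)) (lbr L x Y`_j :: W ++ omit j Y)) X X'.
rewrite /sn_vec_vec /= => ->; rewrite addrC; congr (_ + _).
  rewrite mulr_sumr; apply: eq_bigr => i _; rewrite mulr_sumr; apply: eq_bigr => j _.
  rewrite mul_mon mul1r -catA mon_move; congr mon.
  by rewrite -exprD -signr_odd -[in RHS]signr_odd !oddD; congr (_ ^+ _); parity.
rewrite mulr_suml sg_sum; apply: eq_bigr => i _.
rewrite mulr_suml sg_sum; apply: eq_bigr => j _.
rewrite -catA -cat_cons mon_cat_mul mon_catC sgMr -mon_cat_mul.
rewrite mul_mon mulr1 /= -catA size_omit //; congr sg.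
by have := ltn_ord j; lia.
Qed.

Lemma vec_scal_catl X X' b :
  sn_vec_scal L (X ++ X') b = mon 1 X * sn_vec_scal L X' b +
   sg (odd (size X')) (sn_vec_scal L X b * mon 1 X').
Proof.
have := sum_omit_cat (fun i x W =>
   mon ((-1) ^+ (size (X ++ X') - i.+1) * anchor L x b) W) X X'.
rewrite /sn_vec_scal => ->; rewrite addrC size_cat; congr (_ + _).
  rewrite mulr_sumr; apply: eq_bigr => i _.
  by rewrite mul_mon mul1r -addnS subnDl.
rewrite mulr_suml sg_sum; apply: eq_bigr => i _; rewrite mul_mon mulr1 !mon_sign sgM.
by congr sg; have := ltn_ord i; lia.
Qed.

Lemma scal_vecM a a' Y :
  sn_scal_vec L (a * a') Y = a *: sn_scal_vec L a' Y + a' *: sn_scal_vec L a Y.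
Proof.
rewrite !scaler_sumr -big_split; apply: eq_bigr => i _ /=.
rewrite !scale_mon -monD anchor_der mulrDr addrC [anchor _ _ a * _]mulrC.
by congr mon; congr (_ + _); rewrite mulrCA.
Qed.

Lemma scal_vec_eta (r : R) a Y :
  sn_scal_vec L (eta r * a) Y = eta r *: sn_scal_vec L a Y.
Proof.
rewrite scaler_sumr; apply: eq_bigr => j _.
by rewrite scale_mon anchorZeta mulrCA.
Qed.

Lemma vec_scal_eta (r : R) X b :
  sn_vec_scal L X (eta r * b) = eta r *: sn_vec_scal L X b.
Proof.
rewrite scaler_sumr; apply: eq_bigr => j _.
by rewrite scale_mon anchorZeta mulrCA.
Qed.

Lemma vec_vec_homog X Y :
  ext_homog ((size X)%:Z + (size Y)%:Z - 1) (sn_vec_vec L X Y).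
Proof.
apply: ext_homog_sum => i _; apply: ext_homog_sum => j _.
have := ext_homog_mon ((-1) ^+ (i + j))
  (lbr L X`_i Y`_j :: omit i X ++ omit j Y); rewrite /= size_cat !size_omit //.
by congr ext_homog; have := ltn_ord i; have := ltn_ord j; lia.
Qed.

Lemma vec_scal_homog X b : ext_homog ((size X)%:Z - 1) (sn_vec_scal L X b).
Proof.
apply: ext_homog_sum => i _; have := ext_homog_mon
  ((-1) ^+ (size X - i.+1) * anchor L X`_i b) (omit i X); rewrite size_omit //.
by congr ext_homog; have := ltn_ord i; lia.
Qed.

Lemma scal_vec_homog a Y : ext_homog ((size Y)%:Z - 1) (sn_scal_vec L a Y).
Proof.
apply: ext_homog_sum => i _; have := ext_homog_mon
  ((-1) ^+ i.+1 * anchor L Y`_i a) (omit i Y); rewrite size_omit //.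
by congr ext_homog; have := ltn_ord i; lia.
Qed.

Lemma sn_homog d d' p q :
  ext_homog d p -> ext_homog d' q -> ext_homog (d + d' - 1) (sn L p q).
Proof.
move=> hp hq; elim/ext_homog_ind: p / hp => [|a X <-|p p' hp hp'].
- by rewrite sn0l; apply: ext_homog0.
- elim/ext_homog_ind: q / hq => [|b Y <-|q q' hq hq'].
  + by rewrite sn0r; apply: ext_homog0.
  + rewrite sn_monU; apply: ext_homogD; first apply: ext_homogD; apply: ext_homogZ.
    * exact: vec_vec_homog.
    * rewrite addrAC; apply: ext_homogM (vec_scal_homog _ _) _; exact: ext_homog_mon.
    * rewrite -addrA; apply: ext_homogM _ (scal_vec_homog _ _); exact: ext_homog_mon.
  + by rewrite snDr; apply: ext_homogD.
- by rewrite snDl; apply: ext_homogD.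
Qed.

Lemma vec_vecC X Y : sn_vec_vec L X Y =
  - sg (~~ odd (size X) && ~~ odd (size Y)) (sn_vec_vec L Y X).
Proof.
rewrite /sn_vec_vec exchange_big /= sg_sum -sumrN; apply: eq_bigr => j _.
rewrite sg_sum -sumrN; apply: eq_bigr => i _; rewrite lbrC (monNr _ [::]) /= addnC.
congr (- _).
have E c x U V : mon c (x :: U ++ V) = mon 1 [:: x] * mon c (U ++ V) :> ext g.
  by rewrite mul_mon mul1r.
rewrite !E mon_catC sgMr !size_omit //.
by congr sg; have := ltn_ord i; have := ltn_ord j; lia.
Qed.

Lemma scal_vecE a X : sn_scal_vec L a X = sg (odd (size X)) (sn_vec_scal L X a).
Proof.
rewrite sg_sum; apply: eq_bigr => i _; rewrite !mon_sign sgM; congr sg.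
by have := ltn_ord i; lia.
Qed.

Lemma snC d d' p q : ext_homog d p -> ext_homog d' q ->
  sn L p q = - sg (~~ oddi d && ~~ oddi d') (sn L q p).
Proof.
move=> hp hq; elim/ext_homog_ind: p / hp => [|a X <-|p p' hp hp'].
- by rewrite sn0l sn0r sg0 oppr0.
- elim/ext_homog_ind: q / hq => [|b Y <-|q q' hq hq'].
  + by rewrite sn0l sn0r sg0 oppr0.
  + rewrite !sn_monU !sgD !opprD -!addrA; congr (_ + _).
      by rewrite vec_vecC [b * a]mulrC -scaler_sg -scalerN.
    rewrite addrC; congr (_ + _).
      rewrite scal_vecE sgMr (ext_mulC (ext_homog_mon 1 X) (vec_scal_homog Y a)).
      by rewrite !scaler_sg sgM oppr_sg oddiB1; congr sg; rewrite /oddi /=; parity.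
    rewrite scal_vecE sgMr (ext_mulC (ext_homog_mon 1 Y) (vec_scal_homog X b)).
    rewrite !scaler_sg !sgM oppr_sg oddiB1 -[LHS]/(sg false _); congr sg.
    by rewrite /oddi /=; parity.
  + by rewrite snDl snDr hq hq' sgD opprD.
- by rewrite snDl snDr hp hp' sgD opprD.
Qed.

(** The three parts of [sn_monU] are separately compatible with products. The sign
    of the second term results from moving [X'] across [Y], or across what is left
    of [Y]. *)
Lemma sn_mulE a a' b X X' Y :
  sn L (mon a X * mon a' X') (mon b Y) =
  mon a X * sn L (mon a' X') (mon b Y) +
  sg (odd (size X') && ~~ odd (size Y)) (sn L (mon a X) (mon b Y) * mon a' X').
Proof.
rewrite mul_mon !sn_monU vec_vec_catl vec_scal_catl scal_vecM.
rewrite (mon_scale a X) (mon_scale a' X') -(mulr1 1) -mul_mon mulr1.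
set x := mon 1 X; set x' := mon 1 X'; set y := mon 1 Y.
set s1 := odd _ && _; set s2 := odd _.
rewrite !(ext_scaleAl, ext_scaleAr, scalerDr, mulrDl, mulrDr, sgD, scaler_sg, scalerA).
rewrite !(ext_scaleAl, ext_scaleAr, scaler_sg, sgMl, sgMr, scalerDr, scalerA).
rewrite [LHS](AC (2*2*2) ((1*3*5)*(2*4*6))) /= -!mulrA.
rewrite (ext_mulC (ext_homog_mon 1 Y) (ext_homog_mon 1 X')).
rewrite (ext_mulC (scal_vec_homog a Y) (ext_homog_mon 1 X')) -/x' -/y.
rewrite !(sgMr, scaler_sg, sgM) oddiB1 -!/(oddi _) {1}/oddi /=.
rewrite [b * a]mulrC [b * a']mulrC [a' * (a * b)]mulrCA [a' * a]mulrC.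
congr (_ + _ + _ + (_ + sg _ _ + _)).
  by rewrite /s1 /s2 /oddi /=; parity.
rewrite -[LHS]/(sg false _); congr sg.
by rewrite /s1 /oddi /=; parity.
Qed.

Lemma sn_mul d d' d'' p p' q :
  ext_homog d p -> ext_homog d' p' -> ext_homog d'' q ->
  sn L (p * p') q = p * sn L p' q +
    sg (oddi d' && ~~ oddi d'') (sn L p q * p').
Proof.
move=> hp hp' hq; elim/ext_homog_ind: p / hp => [|a X _|p1 p2 h1 h2].
- by rewrite !mul0r !sn0l mul0r sg0 addr0.
- elim/ext_homog_ind: p' / hp' => [|a' X' <-|p1 p2 h1 h2].
  + by rewrite !mulr0 !sn0l !mulr0 sg0 addr0.
  + elim/ext_homog_ind: q / hq => [|b Y <-|q1 q2 h1 h2].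
    * by rewrite !sn0r mulr0 mul0r sg0 addr0.
    * exact: sn_mulE.
    * by rewrite !snDr h1 h2 mulrDr mulrDl sgD addrACA.
  + by rewrite mulrDr !snDl h1 h2 !mulrDr sgD addrACA.
- by rewrite mulrDl !snDl h1 h2 !mulrDl sgD addrACA.
Qed.

Lemma sn_almost_gerstenhaber : almost_gerstenhaber (@ext_homog A g) (sn L).
Proof.
split.
- exact: ext_homog0.
- exact: ext_homogD.
- exact: ext_homogN.
- exact: (ext_homog_mon 1 [::]).
- exact: ext_homogM.
- exact: sn_homog.
- exact: ext_mulC.
- exact: snDl.
- exact: snDr.
- exact: snC.
- exact: sn_mul.
Qed.

Inductive ext_generator : int -> ext g -> Prop :=
| gen_scal a : ext_generator 0 (mon a [::])
| gen_vec x : ext_generator 1 (mon 1 [:: x]).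

Lemma ext_generator_homog d p : ext_generator d p -> ext_homog d p.
Proof.
by case=> [a|x]; [apply: (ext_homog_mon a [::]) | apply: (ext_homog_mon 1 [:: x])].
Qed.

Lemma ext_ind_mul (P : ext g -> Prop) :
  (forall d p, ext_generator d p -> P p) -> P 0 ->
  (forall p q, P p -> P q -> P (p + q)) ->
  (forall d d' p q, ext_homog d p -> ext_homog d' q -> P p -> P q -> P (p * q)) ->
  forall p, P p.
Proof.
move=> Pg P0 PD PM; elim/ext_ind => // a w.
have -> : mon a w = mon a [::] * mon 1 w by rewrite mul_mon mulr1.
apply: (PM _ _ _ _ (ext_homog_mon _ _) (ext_homog_mon _ _)); first exact: Pg (gen_scal a).
elim: w => [|x w IH]; first exact: Pg (gen_scal 1).
have -> : mon 1 (x :: w) = mon 1 [:: x] * mon 1 w by rewrite mul_mon mulr1.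
apply: (PM _ _ _ _ (ext_homog_mon _ _) (ext_homog_mon _ _) _ IH).
exact: Pg (gen_vec x).
Qed.

Lemma sn_vec_vecE x y : sn L (mon 1 [:: x]) (mon 1 [:: y]) = mon 1 [:: lbr L x y].
Proof.
by rewrite sn_monE /= !scale1r /sn_vec_vec !big_ord1 /omit /= addn0 expr0.
Qed.

Lemma sn_vec_scalE x a : sn L (mon 1 [:: x]) (mon a [::]) = mon (anchor L x a) [::].
Proof. by rewrite sn_monE /= scale1r /sn_vec_scal big_ord1 /omit /= subnn mul1r. Qed.

Lemma sn_scal_vecE x a : sn L (mon a [::]) (mon 1 [:: x]) = - mon (anchor L x a) [::].
Proof.
by rewrite sn_monE /= scale1r /sn_scal_vec big_ord1 /omit /= expr1 mulN1r monN.
Qed.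

Lemma sn_scal_scalE a b : sn L (mon a [::]) (mon b [::]) = 0.
Proof. by rewrite sn_monE. Qed.

(** On three vectors this is the Jacobi identity of the Lie algebra, on two vectors
    and a scalar it says that the anchor is a morphism of Lie algebras, and in the
    other cases all terms vanish for degree reasons. *)
Lemma jacobi_generator d d' d'' p q r :
  ext_generator d p -> ext_generator d' q -> ext_generator d'' r ->
  jacobi (sn L) d' d'' p q r.
Proof.
have snN p' q' : sn L p' (- q') = - sn L p' q'.
  by apply: (@sg_morph _ _ (sn L p') _ true) => ? ?; apply: snDr.
have snNl p' q' : sn L (- p') q' = - sn L p' q'.
  by apply: (@sg_morph _ _ ((sn L)^~ q') _ true) => ? ?; apply: snDl.
have E := (sn_vec_vecE, sn_vec_scalE, sn_scal_vecE, sn_scal_scalE, snN, snNl, sn0l, sn0r).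
case=> [a|x]; case=> [b|y]; case=> [c|z];
  rewrite /jacobi !E ?(sg0, addr0, oppr0, opprK) //=.
all: try by rewrite ?(add0r, subrr, addNr).
- by rewrite anchor_lbr monD monN opprD opprK addrAC addNr add0r.
- by rewrite anchor_lbr monD monN addKr.
- by rewrite anchor_lbr monD monN.
rewrite -(monDr _ [::]); congr (mon 1 [:: _]).
have lbrN y1 y2 : lbr L y1 (- y2) = - lbr L y1 y2.
  by apply: (@sg_morph _ _ (lbr L y1) _ true) => ? ?; apply: lbrDr.
rewrite (lbrC L (lbr L x y)) (lbrC L (lbr L x z)) (lbrC L x z) lbrN opprK.
by apply/esym/eqP; rewrite -subr_eq0 opprK lbr_jacobi.
Qed.

Theorem sn_gerstenhaber : gerstenhaber (@ext_homog A g) (sn L).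
Proof.
have H := sn_almost_gerstenhaber; split=> //.
(* The first argument is reduced to generators by derivation; the symmetry of
   the identity then brings the two others to the first place. *)
have J1 d' d'' q r : ext_homog d' q -> ext_homog d'' r ->
    (forall d p, ext_generator d p -> jacobi (sn L) d' d'' p q r) ->
    forall p, jacobi (sn L) d' d'' p q r.
  move=> hq hr Jg; apply: ext_ind_mul => [//|||d e p p' hp hp'].
  - by rewrite /jacobi !(br0l H) sg0 addr0.
  - by move=> p p'; apply: (jacobiD H).
  - exact: (jacobiM H hp hp' hq hr).
have J2 d d'' p r : ext_homog d p -> ext_homog d'' r ->
    (forall d' q, ext_generator d' q -> jacobi (sn L) d' d'' p q r) ->
    forall d' q, ext_homog d' q -> jacobi (sn L) d' d'' p q r.
  move=> hp hr Jg d' q hq; apply: (jacobi_swap12 H _ hq hp hr).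
  apply: J1 => // e q' gq; have hq' := ext_generator_homog gq.
  by apply: (jacobi_swap12 H _ hp hq' hr); apply: Jg.
have J3 d d' p q : ext_homog d p -> ext_homog d' q ->
    (forall d'' r, ext_generator d'' r -> jacobi (sn L) d' d'' p q r) ->
    forall d'' r, ext_homog d'' r -> jacobi (sn L) d' d'' p q r.
  move=> hp hq Jg d'' r hr; apply: (jacobi_swap23 H _ hr hq).
  apply: (J2 _ _ _ _ hp hq _ _ _ hr) => e r' gr; have hr' := ext_generator_homog gr.
  by apply: (jacobi_swap23 H _ hq hr'); apply: Jg.
move=> d d' d'' p q r hp hq hr; apply: (J1 _ _ _ _ hq hr) => e p' gp {d p hp}.
have hp := ext_generator_homog gp.
apply: (J2 _ _ _ _ hp hr _ _ _ hq) => e' q' gq {d' q hq}.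
have hq := ext_generator_homog gq; apply: (J3 _ _ _ _ hp hq _ _ _ hr) => e'' r' gr.
exact: jacobi_generator gp gq gr.
Qed.

End SchoutenNijenhuis.

(** * The grading *)

Section Components.
Variables (A : comPzRingType) (g : lmodType A).
Implicit Types (p q : ext g) (d : int).

Lemma ext_homog_lt0 d p : d < 0 -> ext_homog d p -> p = 0.
Proof.
move=> d0 hp; elim/ext_homog_ind: p / hp => [//|a w wd|p q -> ->].
  by rewrite -wd in d0.
by rewrite addr0.
Qed.

Lemma ext_homog_absz d p : ext_homog d p -> ext_homog (`|d|%N) p.
Proof.
case: d => // n hp; rewrite (ext_homog_lt0 (isT : Negz n < 0) hp).
exact: ext_homog0.
Qed.

Lemma ext_compD k : {morph @ext_comp A g k : p q / p + q}.
Proof. exact/ext_liftD/alt_comp. Qed.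

Lemma ext_comp0 k : ext_comp k (0 : ext g) = 0.
Proof. by apply: (addrI (ext_comp k 0)); rewrite -ext_compD !addr0. Qed.

Lemma ext_comp_mon k a w :
  ext_comp k (mon a w : ext g) = if size w == k then mon a w else 0.
Proof. exact/ext_lift_mon/alt_comp. Qed.

Lemma ext_compZ k a p : ext_comp k (a *: p) = a *: ext_comp k p.
Proof.
elim/ext_ind: p => [|b w|p q IHp IHq]; first by rewrite scaler0 ext_comp0 scaler0.
  by rewrite scale_mon !ext_comp_mon; case: ifP; rewrite ?scaler0 // scale_mon.
by rewrite scalerDr !ext_compD scalerDr IHp IHq.
Qed.

Lemma ext_comp_homogeneous (k : nat) p : ext_homog k (ext_comp k p).
Proof.
elim/ext_ind: p => [|b w|p q IHp IHq]; first by rewrite ext_comp0; apply: ext_homog0.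
  rewrite ext_comp_mon; case: eqP => [<-|_]; [exact: ext_homog_mon | exact: ext_homog0].
by rewrite ext_compD; apply: ext_homogD.
Qed.

Lemma ext_comp_int (k : nat) d p : ext_homog d p ->
  ext_comp k p = if d == k%:Z then p else 0.
Proof.
case: d => [n|n] hp; first by rewrite (ext_comp_homog k hp) eqz_nat eq_sym.
by rewrite (ext_homog_lt0 (isT : Negz n < 0) hp) ext_comp0.
Qed.

Lemma ext_is_grading (R : pzRingType) (eta : {rmorphism R -> A}) :
  is_grading (V := restr eta (ext g)) (@ext_homog A g).
Proof.
split.
- exact: ext_homog0.
- by move=> d r x y hx hy; apply: ext_homogD => //; apply: ext_homogZ.
- move=> x; exists [seq k%:Z | k <- iota 0 (ext_bound x)].
  exists (fun d => if d is Posz k then ext_comp k x else 0); split.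
    by case=> k; [exact: ext_comp_homogeneous | exact: ext_homog0].
  rewrite big_map /= [LHS](ext_comp_sum (leqnn _)).
  rewrite -[in LHS](big_mkord xpredT (fun k => ext_comp k x)).
  by rewrite /index_iota subn0.
- move=> s c us hc sc d ds.
  case: d ds => [k|n] ds; last exact: (ext_homog_lt0 (isT : Negz n < 0) (hc _)).
  have := congr1 (@ext_comp A g k) sc; rewrite ext_comp0.
  rewrite (big_morph (@ext_comp A g k) (ext_compD k) (ext_comp0 k)).
  under eq_bigr => d _ do rewrite (ext_comp_int k (hc d)).
  rewrite (bigD1_seq k%:Z) //= eqxx big1 ?addr0 // => d /negbTE ->.
  by [].
Qed.

End Components.

(** * The Lie brackets *)

Section LieBracketWords.
Variables (R : realType) (A : comPzRingType) (eta : {rmorphism R -> A}).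
Variables (g : lmodType A) (L : lie_rinehart eta g).

Notation bracket_word := (word_bracket (sn L)).
Notation H := (sn_gerstenhaber L).

(** Scalar multiplication by one half comes from the real structure. *)
Lemma ext_torsion2 (p : ext g) : p + p = 0 -> p = 0.
Proof.
move=> pp; rewrite -[p]scale1r -(rmorph1 eta) [1](splitr (1 : R)) rmorphD scalerDl.
by rewrite -scalerDr pp scaler0.
Qed.

Lemma rprod_ord_word (V : pzRingType) m (e : 'I_m -> int * V) :
  rprod (ord_word e) = \prod_(k < m) (e (rev_ord k)).2.
Proof.
elim: m e => [|m IH] e; first by rewrite big_ord0 /ord_word enum_ord0.
rewrite ord_word_cons /= IH big_ord_recr /=; congr (_ * (e _).2).
  apply: eq_bigr => k _; congr (e _).2; apply: val_inj => /=.
  by rewrite /bump /=; have := ltn_ord k; lia.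
by apply: val_inj; rewrite /= subnn.
Qed.

(** A shuffle of type (2, m) is a splitting whose first block has two entries. The
    degrees enter through their parities only, hence the absolute values. *)
Lemma lie_homog_word m (d : 'I_m.+2 -> int) (x : 'I_m.+2 -> ext g) :
  lie_homog L (fun i => `|d i|%N) x = bracket_word (ord_word (fun i => (d i, x i))).
Proof.
transitivity (unsum (@epar (ext g)) (ord_word (fun i => (d i, x i)))
  (fun I J => if size I == 2 then rprod J * odot2 (sn L) I else 0)); last first.
  apply: eq_unsum => I J _; case: ifP => //.
  by case: I => [|e1 [|e2 [|e3 I]]] //=; rewrite mulr0.
rewrite -(@sum_shuffle _ _ _ _ 2 _ d) //; apply: eq_bigr => s _.
rewrite !ord_word_cons /= take0 drop0 rprod_ord_word /odot /= mulrzA.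
rewrite [X in X *~ _ = _](_ : _ = (\prod_(k < m) x (s (lift ord0 (lift ord0 (rev_ord k))))
   * sn L (x (s (lift ord0 ord0))) (x (s ord0))) *~ koszul d s); last first.
  congr (_ * sn L (x (s _)) (x (s _)) *~ _).
  - apply: eq_bigr => k _; congr (x (s _)); apply: val_inj; rewrite /= inordK.
      by rewrite /bump /=; have := ltn_ord k; lia.
    by have := ltn_ord k; lia.
  - by apply: val_inj; rewrite /= inordK.
  - by apply: val_inj; rewrite /= inordK.
have -> : inord 0 = ord0 :> 'I_m.+2 by apply: val_inj; rewrite /= inordK.
by rewrite mulrzAC sgMr -signr_odd mulrz_sign.
Qed.

Lemma lie_bracket_word n (d : 'I_n -> int) (x : 'I_n -> ext g) :
  (forall i, ext_homog (d i) (x i)) ->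
  lie_bracket L x = bracket_word (ord_word (fun i => (d i, x i))).
Proof.
case: n d x => [|[|m]] d x hx.
- by rewrite /ord_word enum_ord0 /word_bracket /= mulr0.
- by rewrite ord_word_cons /ord_word enum_ord0 /word_bracket /= !mulr0 sg0 addr0.
rewrite -lie_homog_word; apply: lie_bracketE => i; exact: ext_homog_absz.
Qed.

Lemma snZl (r : R) p q : sn L (eta r *: p) q = eta r *: sn L p q.
Proof.
elim/ext_ind: p => [|a X|p p' IH IH']; first by rewrite scaler0 sn0l scaler0.
  elim/ext_ind: q => [|b Y|q q' IH IH']; first by rewrite !sn0r scaler0.
    rewrite scale_mon !sn_monU scal_vec_eta !scalerDr !scalerA.
    by rewrite ext_scaleAr !scalerA mulrA [b * _]mulrC.
  by rewrite !snDr scalerDr IH IH'.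
by rewrite scalerDr !snDl scalerDr IH IH'.
Qed.

Lemma snZr (r : R) p q : sn L p (eta r *: q) = eta r *: sn L p q.
Proof.
elim/ext_ind: p => [|a X|p p' IH IH']; first by rewrite !sn0l scaler0.
  elim/ext_ind: q => [|b Y|q q' IH IH']; first by rewrite scaler0 !sn0r scaler0.
    rewrite scale_mon !sn_monU vec_scal_eta !scalerDr !scalerA.
    by rewrite ext_scaleAl !scalerA mulrCA [a * eta r]mulrC.
  by rewrite scalerDr !snDr scalerDr IH IH'.
by rewrite !snDl scalerDr IH IH'.
Qed.

Lemma ord_word_dfwith (T V : Type) n (F : 'I_n -> V -> T) (v : 'I_n -> V) (i : 'I_n) :
  exists u w, forall z, ord_word (fun j => F j (dfwith (i := i) v z j)) = u ++ F i z :: w.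
Proof.
have := enum_uniq 'I_n; have := mem_enum 'I_n i; rewrite inE /=; rewrite /ord_word.
case/splitPr => r1 r2; rewrite cat_uniq /= negb_or.
case/and3P => _ /andP [i1 _] /andP [i2 _].
exists [seq F j (v j) | j <- r1], [seq F j (v j) | j <- r2] => z.
rewrite map_cat /= dfwith_in.
congr (_ ++ _ :: _); apply/eq_in_map => j jr; rewrite dfwith_out //.
  by apply: contraNneq i1 => ->.
by apply: contraNneq i2 => ->.
Qed.

Lemma lie_homog_slot m (d : 'I_m.+2 -> nat) (v : 'I_m.+2 -> ext g) i (r : R) x y :
  let h z := lie_homog L d (fun j => ext_comp (d j) (dfwith (i := i) v z j)) in
  h (eta r *: x + y) = eta r *: h x + h y.
Proof.
rewrite /=; have [u [w E]] := ord_word_dfwith (fun j z => (Posz (d j), ext_comp (d j) z)) v i.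
rewrite !(@lie_homog_word m (fun j => d j)) !E ext_compD ext_compZ.
apply: (word_bracket_slot H (h := fun z => eta r *: z)) => *.
- exact: scalerDr.
- exact/esym/ext_scaleAl.
- exact/esym/ext_scaleAr.
- exact: snZl.
- exact: snZr.
Qed.

(** Enlarging the range of the degrees only adds vanishing components. With a bound
    common to several arguments, the brackets can be compared term by term. *)
Lemma lie_bracket_bound m N (x : 'I_m.+2 -> ext g) :
  (forall i, ext_bound (x i) <= N)%N ->
  lie_bracket L x = \sum_(d : {ffun 'I_m.+2 -> 'I_N})
    lie_homog L (fun i => d i) (fun i => ext_comp (d i) (x i)).
Proof.
move=> xN; rewrite /lie_bracket; set N0 := \max_i _.
have N0N : (N0 <= N)%N by apply/bigmax_leqP => i _; apply: xN.
pose F (d : 'I_m.+2 -> nat) := lie_homog L d (fun i => ext_comp (d i) (x i)).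
have F0 (d : 'I_m.+2 -> nat) : ~~ [forall i, d i < N0]%N -> F d = 0.
  rewrite negb_forall => /existsP [i]; rewrite -leqNgt => Ni.
  apply: (lie_homog0 _ _ (i := i)); apply: ext_comp_bound.
  by apply: leq_trans Ni; apply: (leq_bigmax i).
rewrite [RHS](bigID (fun d : {ffun 'I_m.+2 -> 'I_N} => [forall i, d i < N0]%N)) /=.
rewrite [X in _ = _ + X]big1 ?addr0 => [|d /F0 //].
have N0_gt0 : (0 < N0)%N.
  by apply: (@leq_trans (ext_bound (x ord0))) => //; apply: (leq_bigmax ord0).
pose h (d : {ffun 'I_m.+2 -> 'I_N0}) : {ffun 'I_m.+2 -> 'I_N} :=
  [ffun i => widen_ord N0N (d i)].
pose h' (d : {ffun 'I_m.+2 -> 'I_N}) : {ffun 'I_m.+2 -> 'I_N0} :=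
  [ffun i => insubd (Ordinal N0_gt0) (val (d i))].
rewrite (reindex_onto h h') /= => [|d /forallP dN0]; last first.
  by apply/ffunP => i; apply: val_inj; rewrite !ffunE /= val_insubd dN0.
apply: eq_big => [d|d _]; last first.
  by congr lie_homog; apply/funext => i; rewrite ffunE.
apply/esym/andP; split; first by apply/forallP => i; rewrite ffunE /=.
by apply/eqP/ffunP => i; apply: val_inj; rewrite !ffunE /= val_insubd ltn_ord.
Qed.

Lemma lie_bracket_linear n (v : 'I_n.+1 -> ext g) i (r : R) x y :
  let h z := lie_bracket L (dfwith (i := i) v z) in
  h (eta r *: x + y) = eta r *: h x + h y.
Proof.
case: n v i => [|m] v i; first by rewrite /= scaler0 addr0.
pose b z := \max_j ext_bound (dfwith (i := i) v z j).
pose N := maxn (b (eta r *: x + y)) (maxn (b x) (b y)).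
have bN z : (b z <= N)%N -> forall j, (ext_bound (dfwith (i := i) v z j) <= N)%N.
  by move=> zN j; apply: leq_trans zN; apply: (leq_bigmax j).
cbv beta zeta; rewrite !(@lie_bracket_bound _ N); try by apply: bN; rewrite /N; lia.
rewrite scaler_sumr -big_split; apply: eq_bigr => d _.
exact: lie_homog_slot.
Qed.

Lemma hom_ord_word n (d : 'I_n -> int) (x : 'I_n -> ext g) :
  (forall i, ext_homog (d i) (x i)) ->
  List.Forall (ehom (@ext_homog A g)) (ord_word (fun i => (d i, x i))).
Proof.
move=> hx; rewrite /ord_word; elim: (enum _) => [|i s IH] /=; first by constructor.
by constructor; first exact: hx.
Qed.

Lemma wdeg_ord_word n (d : 'I_n -> int) (x : 'I_n -> ext g) :
  wdeg (ord_word (fun i => (d i, x i))) = \sum_i d i.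
Proof. by rewrite /wdeg big_map big_enum. Qed.

Lemma lie_bracket_homog n (d : 'I_n -> int) (x : 'I_n -> ext g) :
  (forall i, ext_homog (d i) (x i)) ->
  ext_homog (\sum_i d i - 1) (lie_bracket L x).
Proof.
move=> hx; rewrite (lie_bracket_word hx) -(wdeg_ord_word d x).
exact: (word_bracket_hom H (hom_ord_word hx)).
Qed.

Lemma lie_bracket_symmetric n (d : 'I_n -> int) (x : 'I_n -> ext g) (s : 'S_n) :
  (forall i, ext_homog (d i) (x i)) ->
  lie_bracket L x = lie_bracket L (fun i => x (s i)) *~ koszul d s.
Proof.
move=> hx; rewrite (lie_bracket_word hx) (lie_bracket_word (fun i => hx (s i))).
apply: (koszul_symmetric (par := @epar _) (P := ehom (@ext_homog A g))
  (e := fun i => (d i, x i))) => //.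
exact: (word_bracket_swap H).
Qed.

Lemma word_bracket0 (d : int) u v : bracket_word (u ++ (d, 0) :: v) = 0.
Proof.
have := @word_bracket_slot _ _ _ H id d 0 0 u v; rewrite addr0 => E.
by apply: (addrI (bracket_word (u ++ (d, 0) :: v))); rewrite addr0 -E.
Qed.

(** Summing over the size of the first block gives all the splittings; the one with
    an empty first block contributes a bracket with an entry 0. *)
Lemma lie_bracket_jacobi n (d : 'I_n.+1 -> int) (v : 'I_n.+1 -> ext g) :
  (forall i, ext_homog (d i) (v i)) ->
  \sum_(j < n.+1) \sum_(s : 'S_n.+1 | shuffle j.+1 s)
    lie_bracket L (fun i : 'I_(n - j).+1 =>
      if i == 0%N :> nat then lie_bracket L (fun l : 'I_j.+1 => v (s (inord l)))
      else v (s (inord (j + i)))) *~ koszul d s = 0.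
Proof.
move=> hv; pose e i := (d i, v i).
pose F I J := bracket_word ((wdeg I - 1, bracket_word I) :: J).
have hw (s : 'S_n.+1) : List.Forall (ehom (@ext_homog A g)) (ord_word (fun i => e (s i))).
  exact: hom_ord_word.
transitivity (\sum_(j < n.+1) unsum (@epar _) (ord_word e)
    (fun I J => if size I == j.+1 then F I J else 0)).
  apply: eq_bigr => j _; rewrite -(@sum_shuffle _ _ _ _ _ _ d) //.
  apply: eq_bigr => s _; congr (_ *~ _); cbv beta zeta.
  set I := take _ _; set J := drop _ _.
  have EI : I = ord_word (fun l : 'I_j.+1 => (d (s (inord l)), v (s (inord l)))).
    exact: ord_word_take.
  have BI : lie_bracket L (fun l : 'I_j.+1 => v (s (inord l))) = bracket_word I.
    by rewrite EI; apply: lie_bracket_word.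
  rewrite BI (@lie_bracket_word _ (fun i =>
    if i == 0%N :> nat then wdeg I - 1 else d (s (inord (j + i))))).
    rewrite ord_word_cons /F; congr (bracket_word (_ :: _)).
    rewrite /J (@ord_word_drop _ n j.+1 (fun i => e (s i))) subSS.
    by apply: eq_map => i /=; rewrite /bump /= add1n addnS.
  move=> i; case: eqP => // _; apply: (word_bracket_hom H).
  by rewrite EI; apply: hom_ord_word.
rewrite unsum_sum -[RHS](word_bracket_jacobi H ext_torsion2 (hom_ord_word hv)).
apply: eq_unsum => I J /unshuffle_size; rewrite size_ord_word => IJ.
case: I IJ => [|e1 I] IJ.
  rewrite big1 // /word_bracket /= mulr0.
  exact/esym/(word_bracket0 _ [::]).
have In : (size I < n.+1)%N by move: IJ; rewrite /=; lia.
rewrite (bigD1 (Ordinal In)) //= eqxx big1 ?addr0 // => j.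
by rewrite -val_eqE /= eqSS eq_sym => /negbTE ->.
Qed.

End LieBracketWords.

Theorem theorem3p3 (R : realType) (A : comPzRingType)
    (eta : {rmorphism R -> A}) (g : lmodType A) (L : lie_rinehart eta g) :
  lie_infinity (V := restr eta (ext g)) (@ext_homog A g) (@lie_bracket R A eta g L)
  /\ (forall (d : int) (x : restr eta (ext g)), d < 0 -> ext_homog d x -> x = 0).
Proof.
split; last by move=> d x; apply: ext_homog_lt0.
split.
- exact: ext_is_grading.
- exact: lie_bracket_linear.
- move=> k d v; exact: lie_bracket_homog.
- move=> k d v s; exact: lie_bracket_symmetric.
- move=> n d v; exact: lie_bracket_jacobi.
Qed.
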